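(* Let $\hbar\in\mathbb{C}^\times$ and fix a local frame $\omega_0^\hbar$ of $\mathcal{L}$ solving the $\hbar$-deformed Picard--Fuchs equation in cohomology $$\hbar^3\nabla_u^3\omega_0^\hbar=-b_2\hbar^2\nabla_u^2\omega_0^\hbar-b_1\hbar\nabla_u\omega_0^\hbar-b_0\,\omega_0^\hbar .$$ Let $\omega^\hbar_{\mathrm{GM}}=(\omega_0^\hbar,\hbar\nabla_u\omega_0^\hbar,\hbar^2\nabla_u^2\omega_0^\hbar)$ and $\omega^\hbar_{\mathrm{NAH}}=(\omega_0^\hbar,\hbar\,\omega_1^\hbar,\hbar^2\omega_2^\hbar)$. Then the gauge transformation $\mathcal{A}^\hbar$ defined by $\omega^\hbar_{\mathrm{GM}}=\omega^\hbar_{\mathrm{NAH}}\,\mathcal{A}^\hbar$ is given by $$(\mathcal{A}^\hbar)^{-1}=\begin{pmatrix}1&\hbar K_u&\hbar^2B_{uu}\\0&1&\hbar K_u+\tfrac13b_2\\0&0&1\end{pmatrix},$$ $$B_{uu}=\tfrac12K_u^2-\tfrac{1}{9\hbar^2}b_2^2-\tfrac{1}{6\hbar}\partial_ub_2+\tfrac{1}{2\hbar^2}b_1=\partial_uK_u+\tfrac{1}{3\hbar}b_2K_u ,$$ and $\mathcal{A}^\hbar$ transforms the non-abelian Hodge flat connection $\nabla^\hbar_{\mathrm{NAH}}=\frac1\hbar\varphi+D+\hbar\varphi^\dagger$ into the oper $\nabla^\hbar_{\mathrm{GM}}$, i.e. $$\nabla^\hbar_{\mathrm{GM}}=(\mathcal{A}^\hbar)^{-1}\circ\nabla^\hbar_{\mathrm{NAH}}\circ\mathcal{A}^\hbar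 .$$ In particular $\nabla^\hbar_{\mathrm{NAH}}$ is gauge equivalent to $\nabla^\hbar_{\mathrm{GM}}$.
   Context: Let $n\ge1$, let $M\cong U\perp E_8\perp E_8\perp\langle-2n\rangle$ (rank 19, $U$ the hyperbolic plane, $E_8$ negative definite), $\mathcal{B}=\mathbb{CP}^1-\{0,1,\infty\}$, and let $\pi:\mathcal{X}\to\mathcal{B}$ be a complete family of $M$-polarized K3 surfaces with fibers $X_u$ (complete: $T_u\mathcal{B}\cong H^{1,1}(X_u)/j_u(M)_{\mathbb{C}}$ via deformations, with $j_u:M\hookrightarrow\mathrm{Pic}(X_u)$ the polarization). $T(X_u)=M^\perp\subset H^2(X_u,\mathbb{Z})$ is a Hodge substructure of rank 3 with one-dimensional Hodge components, written $H^{2,0},H^{1,1},H^{0,2}$ (instead of $T^{p,q}$). $\mathcal{H}$ denotes the resulting rank 3 bundle on $\mathcal{B}$ with fibers $T(X_u)\otimes\mathbb{C}$, flat Gauss--Manin connection $\nabla$, and Hodge filtration; $\mathcal{L}=F^2$ is the holomorphic line bundle with fibers $H^{2,0}(X_u)$. Polarization: $Q(\alpha,\beta)=-\int_{X_u}\alpha\wedge\beta$; Weil operator $W|_{H^{p,q}}=i^{p-q}$; Hodge metric $h(\alpha,\beta)=Q(W\alpha,\bar\beta)$. Let $u$ be a local coordinate on $\mathcal{B}$, $\nabla_u=\nabla_{\partial/\partial u}$. The cotangent bundle is trivialized by $du$. The functions $b_0,b_1,b_2$ are holomorphic in $u$ (rational functions on $\mathcal{B}$). For the local holomorphic frame $\omega_0^\hbar$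 put $$e^{-K}=h(\omega_0^\hbar,\omega_0^\hbar)=\int_{X_u}\omega_0^\hbar\wedge\overline{\omega_0^\hbar},\quad K_u=\partial_uK,\quad G_{u\bar u}=\partial_u\partial_{\bar u}K,\quad \Gamma^u_{uu}=G_{u\bar u}^{-1}\partial_uG_{u\bar u},$$ and $\omega_1^\hbar=(\nabla_u-D_u)\omega_0^\hbar\in H^{1,1}$, $\omega_2^\hbar=(\nabla_u-D_u)\omega_1^\hbar\in H^{0,2}$, where $D_u\omega_a^\hbar=h_{a\bar a}^{-1}(\partial_uh_{a\bar a})\,\omega_a^\hbar$ with $h_{a\bar a}=h(\omega_a^\hbar,\omega_a^\hbar)$; one has $(h_{a\bar b})=\mathrm{diag}(e^{-K},e^{-K}G_{u\bar u},e^{-K}G_{u\bar u}^2)$. The connections are the matrix operators $$\nabla^\hbar_{\mathrm{NAH}}=d+\frac1\hbar\begin{pmatrix}0&0&0\\1&0&0\\0&1&0\end{pmatrix}du+\mathrm{diag}(-K_u,\ \Gamma^u_{uu}-K_u,\ 2\Gamma^u_{uu}-K_u)\,du+\hbar\begin{pmatrix}0&G_{u\bar u}&0\\0&0&G_{u\bar u}\\0&0&0\end{pmatrix}d\bar u$$ (the three non-trivial terms being $\frac1\hbar\varphi$, the connection form of the Chern connection $D$ of $h$, and $\hbar\varphi^\dagger$), and $$\nabla^\hbar_{\mathrm{GM}}=d+\frac1\hbar\begin{pmatrix}0&0&-b_0\\1&0&-b_1\\0&1&-b_2\end{pmatrix}du .$$ For a connection $d+\Theta$, $\mathcal{A}^{-1}\circ(d+\Theta)\circ\mathcal{A}=d+\mathcal{A}^{-1}d\mathcal{A}+\mathcal{A}^{-1}\Theta\mathcal{A}$.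 *)

(* Defs.v *)
(* MathComp / MathComp-Analysis; the complex numbers are R[i] for R : realType. *)
From HB Require Import structures.
From mathcomp Require Import all_boot all_order all_algebra.
From mathcomp Require Import complex.
From mathcomp Require Import all_classical all_reals all_analysis.

Set Implicit Arguments.
Unset Strict Implicit.
Unset Printing Implicit Defensive.

Import numFieldNormedType.Exports.
Import Order.TTheory GRing.Theory Num.Theory.
Local Open Scope classical_set_scope.
Local Open Scope ring_scope.
Local Open Scope complex_scope.

Section Calculus.
Variable R : realType.
Local Notation C := R[i].
Implicit Types (D : set C) (f : C -> C) (z v : C).

(* R[i] carries no topology by default; its regular alias carries the one
   induced by the modulus. *)
Definition openC D : Prop := open (D : set C^o).

(* Derivative of f at z in the real direction v; C = R^2 has directions 1 and i. *)
Definition pderivable v f z : Prop :=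
  derivable (fun t : R => complex.Re (f (z + v * t%:C))) 0 1 /\
  derivable (fun t : R => complex.Im (f (z + v * t%:C))) 0 1.

Definition pderiv v f z : C :=
  derive1 (fun t : R => complex.Re (f (z + v * t%:C))) 0
  +i* derive1 (fun t : R => complex.Im (f (z + v * t%:C))) 0.

Fixpoint Ck (k : nat) D f : Prop :=
  (forall z, D z -> {for z, continuous (f : C^o -> C^o)}) /\
  if k is k'.+1 then
    [/\ forall z, D z -> pderivable 1 f z /\ pderivable 'i%C f z,
        Ck k' D (pderiv 1 f) & Ck k' D (pderiv 'i%C f)]
  else True.

Definition smooth D f : Prop := forall k, Ck k D f.

(* Wirtinger operators d/du and d/d(ubar). *)
Definition du f z : C := (pderiv 1 f z - 'i%C * pderiv 'i%C f z) / 2.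
Definition dub f z : C := (pderiv 1 f z + 'i%C * pderiv 'i%C f z) / 2.

(* As for sections of a smooth bundle with a d-bar operator: C^oo and
   annihilated by d/d(ubar). *)
Definition holomorphic D f : Prop :=
  smooth D f /\ forall z, D z -> dub f z = 0.

Definition smooth_mx D m p (F : C -> 'M[C]_(m, p)) : Prop :=
  forall i j, smooth D (fun z => F z i j).

Definition holomorphic_mx D m p (F : C -> 'M[C]_(m, p)) : Prop :=
  forall i j, holomorphic D (fun z => F z i j).

Definition du_mx m p (F : C -> 'M[C]_(m, p)) z : 'M[C]_(m, p) :=
  \matrix_(i, j) du (fun w => F w i j) z.

Definition dub_mx m p (F : C -> 'M[C]_(m, p)) z : 'M[C]_(m, p) :=
  \matrix_(i, j) dub (fun w => F w i j) z.

(* D is the range of a local coordinate u on CP^1 - {0, 1, oo}; x is the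
   inverse of u. *)
Definition coordinate_range D : Prop :=
  openC D /\
  exists x : C -> C,
    [/\ holomorphic D x,
        forall z w, D z -> D w -> x z = x w -> z = w
      & forall z, D z -> x z <> 0 /\ x z <> 1].

Definition holomorphic_subbundle D d (E : C -> 'M[C]_d) : Prop :=
  forall z, D z -> exists (V : set C) (r : nat) (F : C -> 'M[C]_(r, d)),
    [/\ openC V, V z, holomorphic_mx V F
      & forall w, V w -> row_free (F w) /\ (F w :=: E w)%MS].

End Calculus.

(* Lattices are given by Gram matrices acting on integer row vectors. *)
Definition gramU : 'M[int]_2 := \matrix_(i, j) (i != j)%:R.

(* Bourbaki labelling, shifted by one: chain 0-2-3-4-5-6-7 with 1 joined to 3. *)
Definition E8_edges : seq (nat * nat) :=
  [:: (0, 2); (2, 3); (3, 4); (4, 5); (5, 6); (6, 7); (1, 3)]%N.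

Definition gramE8 : 'M[int]_8 := \matrix_(i, j)
  if i == j then -2
  else (((i : nat, j : nat) \in E8_edges) || ((j : nat, i : nat) \in E8_edges))%:R.

Definition dsum m p (A : 'M[int]_m) (B : 'M[int]_p) : 'M[int]_(m + p) :=
  block_mx A 0 0 B.

Definition gramM (n : nat) : 'M[int]_19 :=
  dsum gramU (dsum gramE8 (dsum gramE8 (- n.*2%:R)%:M)).

Definition gramK3 : 'M[int]_22 :=
  dsum gramU (dsum gramU (dsum gramU (dsum gramE8 gramE8))).

Definition isometric_embedding (n : nat) (j : 'M[int]_(19, 22)) : Prop :=
  j *m gramK3 *m j^T = gramM n.

Definition primitive_embedding (j : 'M[int]_(19, 22)) : Prop :=
  forall (k : int) (v : 'rV[int]_22), k != 0 ->
    (exists a : 'rV[int]_19, k *: v = a *m j) ->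
    exists a : 'rV[int]_19, v = a *m j.

Section Family.
Variable R : realType.
Local Notation C := R[i].

(* H^2(X_u, C) is trivialised by flat sections, so a section of it is a
   C^22-valued function, nabla_u is du_mx and conjugation is entrywise. *)
Local Notation H2 := 'rV[C]_22.

Definition toC m p (A : 'M[int]_(m, p)) : 'M[C]_(m, p) := map_mx intr A.
Definition conj_mx m p (A : 'M[C]_(m, p)) : 'M[C]_(m, p) := map_mx conjc A.

(* The integral of a /\ b over X_u. *)
Definition cup (a b : H2) : C := (a *m toC gramK3 *m b^T) 0 0.

Definition polQ (a b : H2) : C := - cup a b.

Definition nabla (s : C -> H2) : C -> H2 := du_mx s.

(* M_C and T_C = (M^perp)_C inside H^2(X_u, C), as row spaces. *)
Definition spanM (j : 'M[int]_(19, 22)) : 'M[C]_(19, 22) := toC j.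
Definition spanT (j : 'M[int]_(19, 22)) : 'M[C]_22 :=
  kermx (toC gramK3 *m (toC j)^T).

(* A decomposition H^2 = H^{2,0} + H^{1,1} + H^{0,2} into row spaces. *)
Record hodge_dec : Type := HodgeDec
  { H20 : 'M[C]_22; H11 : 'M[C]_22; H02 : 'M[C]_22 }.

Definition proj20 (H : hodge_dec) : 'M[C]_22 := proj_mx (H20 H) (H11 H + H02 H)%MS.
Definition proj11 (H : hodge_dec) : 'M[C]_22 := proj_mx (H11 H) (H20 H + H02 H)%MS.
Definition proj02 (H : hodge_dec) : 'M[C]_22 := proj_mx (H02 H) (H20 H + H11 H)%MS.

(* The Weil operator, equal to i^(p-q) on H^{p,q}. *)
Definition weil (H : hodge_dec) (a : H2) : H2 :=
  'i%C ^+ 2 *: (a *m proj20 H) + a *m proj11 H + 'i%C ^- 2 *: (a *m proj02 H).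

Definition herm (H : hodge_dec) (a b : H2) : C := polQ (weil H a) (conj_mx b).

(* The last two fields are orthogonality of H^{p,q} and H^{r,s} unless
   p + r = 2, and the first Hodge-Riemann relation on H^{2,0}. *)
Definition K3_hodge_structure (H : hodge_dec) : Prop :=
  [/\ [/\ \rank (H20 H) = 1%N, \rank (H11 H) = 20%N, \rank (H02 H) = 1%N
        & (H20 H + H11 H + H02 H :=: 1%:M)%MS],
      (conj_mx (H20 H) :=: H02 H)%MS,
      (conj_mx (H11 H) :=: H11 H)%MS,
      [/\ H20 H *m toC gramK3 *m (H20 H)^T = 0,
          H20 H *m toC gramK3 *m (H11 H)^T = 0,
          H02 H *m toC gramK3 *m (H11 H)^T = 0
        & H02 H *m toC gramK3 *m (H02 H)^T = 0]
    & forall a : H2, (a <= H20 H)%MS -> a != 0 -> 0 < cup a (conj_mx a)].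

(* T is a polarized Hodge substructure of rank 3 whose components are lines. *)
Definition transcendental_HS (j : 'M[int]_(19, 22)) (H : hodge_dec) : Prop :=
  [/\ [/\ \rank (spanT j :&: H20 H)%MS = 1%N,
          \rank (spanT j :&: H11 H)%MS = 1%N
        & \rank (spanT j :&: H02 H)%MS = 1%N],
      (spanT j :=: (spanT j :&: H20 H) + (spanT j :&: H11 H)
                   + (spanT j :&: H02 H))%MS
    & forall a : H2, (a <= spanT j)%MS -> a != 0 -> 0 < herm H a a].

(* Sections of F^2 = H^{2,0} on V without zeros. *)
Definition local_frame (X : C -> hodge_dec) (V : set C) (s : C -> H2) : Prop :=
  holomorphic_mx V s /\
  forall z, V z -> (s z <= H20 (X z))%MS /\ s z != 0.

(* A family of M-polarized K3 surfaces over a coordinate patch on which the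
   local system of second cohomology groups is trivial, represented by the
   variation of Hodge structure it induces. In [fam_complete], the tangent vector
   c d/du is sent to the class of c times the H^{1,1} component of nabla_u s
   in H^{1,1}/M_C, where the section s trivialises H^{2,0}. *)
Record complete_polarized_family (n : nat) (D : set C)
    (j : 'M[int]_(19, 22)) (X : C -> hodge_dec) : Prop := CompletePolarizedFamily
  { fam_isometric : isometric_embedding n j;
    fam_primitive : primitive_embedding j;
    fam_hodge : forall z, D z -> K3_hodge_structure (X z);
    fam_in_Pic : forall z, D z -> (spanM j <= H11 (X z))%MS;
    fam_transcendental : forall z, D z -> transcendental_HS j (X z);
    fam_holomorphic_F2 : holomorphic_subbundle D (fun z => H20 (X z));
    fam_holomorphic_F1 : holomorphic_subbundle D (fun z => (H20 (X z) + H11 (X z))%MS);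
    fam_transversal : forall (V : set C) (s : C -> H2),
      openC V -> V `<=` D -> holomorphic_mx V s ->
      (forall z, V z -> (s z <= H20 (X z))%MS) ->
      forall z, V z -> (nabla s z <= H20 (X z) + H11 (X z))%MS;
    fam_complete : forall (V : set C) (s : C -> H2),
      openC V -> V `<=` D -> local_frame X V s ->
      forall z, V z ->
        (forall c : C,
           (c *: (nabla s z *m proj11 (X z)) <= spanM j)%MS -> c = 0) /\
        (forall a : H2, (a <= H11 (X z))%MS -> exists c : C,
           (a - c *: (nabla s z *m proj11 (X z)) <= spanM j)%MS) }.

Definition hnorm (X : C -> hodge_dec) (s : C -> H2) (z : C) : C :=
  herm (X z) (s z) (s z).

(* D_u s = h(s,s)^-1 (d_u h(s,s)) s *)
Definition chernD (X : C -> hodge_dec) (s : C -> H2) (z : C) : H2 :=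
  ((hnorm X s z)^-1 * du (hnorm X s) z) *: s z.

Definition omega1 (X : C -> hodge_dec) (w0 : C -> H2) (z : C) : H2 :=
  nabla w0 z - chernD X w0 z.
Definition omega2 (X : C -> hodge_dec) (w0 : C -> H2) (z : C) : H2 :=
  nabla (omega1 X w0) z - chernD X (omega1 X w0) z.

(* Solves e^{-K} = h(w0, w0), which is a positive real number on D. *)
Definition potK (X : C -> hodge_dec) (w0 : C -> H2) (z : C) : C :=
  (- ln (complex.Re (hnorm X w0 z)))%:C.
Definition Ku (X : C -> hodge_dec) (w0 : C -> H2) : C -> C := du (potK X w0).
Definition Guu (X : C -> hodge_dec) (w0 : C -> H2) : C -> C :=
  du (dub (potK X w0)).
Definition Gammau (X : C -> hodge_dec) (w0 : C -> H2) (z : C) : C :=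
  (Guu X w0 z)^-1 * du (Guu X w0) z.

Definition frameGM (hbar : C) (w0 : C -> H2) (z : C) : seq H2 :=
  [:: w0 z; hbar *: nabla w0 z; hbar ^+ 2 *: nabla (nabla w0) z].
Definition frameNAH (X : C -> hodge_dec) (hbar : C) (w0 : C -> H2) (z : C)
  : seq H2 :=
  [:: w0 z; hbar *: omega1 X w0 z; hbar ^+ 2 *: omega2 X w0 z].

(* w' = w A, where a frame is a row of three vectors. *)
Definition frame_change (w w' : seq H2) (A : 'M[C]_3) : Prop :=
  forall b : 'I_3, w'`_b = \sum_(a < 3) A a b *: w`_a.

Definition mx3 (s : seq (seq C)) : 'M[C]_3 := \matrix_(i, j) (nth [::] s i)`_j.

(* The connection d + conn_u du + conn_ub d(ubar) on a trivial rank 3 bundle. *)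
Record connection : Type := Connection
  { conn_u : C -> 'M[C]_3; conn_ub : C -> 'M[C]_3 }.

Definition gauge_act (A : C -> 'M[C]_3) (T : connection) : connection := Connection
  (fun z => invmx (A z) *m du_mx A z + invmx (A z) *m conn_u T z *m A z)
  (fun z => invmx (A z) *m dub_mx A z + invmx (A z) *m conn_ub T z *m A z).

Definition conn_eq (D : set C) (T T' : connection) : Prop :=
  forall z, D z -> conn_u T z = conn_u T' z /\ conn_ub T z = conn_ub T' z.

Definition gauge_transformation (D : set C) (A : C -> 'M[C]_3) : Prop :=
  smooth_mx D A /\ forall z, D z -> A z \in unitmx.

Definition gauge_equivalent (D : set C) (T T' : connection) : Prop :=
  exists2 A, gauge_transformation D A & conn_eq D (gauge_act A T) T'.

Definition higgs : 'M[C]_3 :=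
  mx3 [:: [:: 0; 0; 0]; [:: 1; 0; 0]; [:: 0; 1; 0]].
Definition chern_form (X : C -> hodge_dec) (w0 : C -> H2) (z : C) : 'M[C]_3 :=
  mx3 [:: [:: - Ku X w0 z; 0; 0];
          [:: 0; Gammau X w0 z - Ku X w0 z; 0];
          [:: 0; 0; 2 * Gammau X w0 z - Ku X w0 z]].
Definition higgs_dag (X : C -> hodge_dec) (w0 : C -> H2) (z : C) : 'M[C]_3 :=
  mx3 [:: [:: 0; Guu X w0 z; 0]; [:: 0; 0; Guu X w0 z]; [:: 0; 0; 0]].

Definition connNAH (X : C -> hodge_dec) (hbar : C) (w0 : C -> H2) : connection :=
  Connection (fun z => hbar^-1 *: higgs + chern_form X w0 z)
             (fun z => hbar *: higgs_dag X w0 z).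

Definition connGM (hbar : C) (b0 b1 b2 : C -> C) : connection :=
  Connection
    (fun z => hbar^-1 *: mx3 [:: [:: 0; 0; - b0 z];
                                 [:: 1; 0; - b1 z];
                                 [:: 0; 1; - b2 z]])
    (fun=> 0).

Definition picard_fuchs (D : set C) (hbar : C) (b0 b1 b2 : C -> C)
    (w0 : C -> H2) : Prop :=
  forall z, D z ->
    hbar ^+ 3 *: nabla (nabla (nabla w0)) z =
      - (b2 z * hbar ^+ 2) *: nabla (nabla w0) z
      - (b1 z * hbar) *: nabla w0 z - b0 z *: w0 z.

Definition Buu (X : C -> hodge_dec) (hbar : C) (b1 b2 : C -> C)
    (w0 : C -> H2) (z : C) : C :=
  Ku X w0 z ^+ 2 / 2 - b2 z ^+ 2 / (9 * hbar ^+ 2)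
  - du b2 z / (6 * hbar) + b1 z / (2 * hbar ^+ 2).
Definition Buu' (X : C -> hodge_dec) (hbar : C) (b2 : C -> C)
    (w0 : C -> H2) (z : C) : C :=
  du (Ku X w0) z + b2 z * Ku X w0 z / (3 * hbar).

Definition Ainv (X : C -> hodge_dec) (hbar : C) (b1 b2 : C -> C)
    (w0 : C -> H2) (z : C) : 'M[C]_3 :=
  mx3 [:: [:: 1; hbar * Ku X w0 z; hbar ^+ 2 * Buu X hbar b1 b2 w0 z];
          [:: 0; 1; hbar * Ku X w0 z + b2 z / 3];
          [:: 0; 0; 1]].

End Family.

(* Main.v *)
Require Import Defs.
From HB Require Import structures.
From mathcomp Require Import all_boot all_order all_algebra.
From mathcomp Require Import complex.
From mathcomp Require Import all_classical all_reals all_analysis.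
From mathcomp Require Import ring lra.
Import numFieldNormedType.Exports.
Import Order.TTheory GRing.Theory Num.Theory.
Local Open Scope classical_set_scope.
Local Open Scope ring_scope.
Local Open Scope complex_scope.

Set Implicit Arguments.
Unset Strict Implicit.
Unset Printing Implicit Defensive.

(* Let w span H^{2,0} and h = (w, conj w) > 0, so K = - ln h. Since w is
   holomorphic, om1 = w' + K_u w is the H^{1,1} part of w'; it is nonzero by
   completeness, and its Hodge norm is h G. In the rank 3 space T, pairing the
   Picard-Fuchs equation with w gives Y' = -2 p Y for Y = (w', w'), p = b2/(3 hbar).
   The H^{1,1} part of T is a real line, so |Y| = h G, and taking logarithmic
   derivatives gives Gamma = K_u - p. Then om2 is orthogonal to conj w and om1,
   hence om2 = -(Y/h) conj w and om2' = (K_u - 2p) om2. Comparing the coefficients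
   of w and w' in this equation with the Picard-Fuchs equation gives the two
   expressions of B_uu and the entry b0 of the oper; the rest is 3 x 3 matrix
   algebra. *)

(** The factor 1/3 in [p] is forced by differentiating isotropy: from (w, w') = 0 and (w, w'') = -Y
    one gets (w, w''') = -(3/2) Y'. The d(ubar) part of the gauge identity is not pure algebra: it
    requires the ubar-derivative of B to be K_u G, which follows from Gamma = K_u - p and from the
    commutation of [du] and [dub]. That commutation also makes derivatives of holomorphic sections
    holomorphic; holomorphy being smoothness plus a vanishing [dub], it rests on the symmetry of
    real mixed derivatives. All vectors stay in C^22. That w, w', w'' are independent is read off
    their Gram matrix, which is zero above the antidiagonal and has -Y, Y, -Y on it; this justifies
    comparing coefficients and makes the gauge matrix unique. *)

(** * Continuity of complex functions *)

Definition eps_continuous (K : numFieldType) (f : K -> K) (z : K) : Prop :=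
  forall e, 0 < e -> exists2 d, 0 < d &
    forall w, `|w - z| < d -> `|f w - f z| < e.

Lemma eps_continuousP (K : numFieldType) (f : K -> K) (z : K) :
  eps_continuous f z <-> {for z, continuous (f : K^o -> K^o)}.
Proof.
split=> [h A /nbhs_ballP [e /= e0 hA]|cf e e0].
  have [d d0 hd] := h e e0.
  apply/nbhs_ballP; exists d => // w; rewrite /ball /= distrC => /hd hw.
  by apply: hA; rewrite /ball /= distrC.
have /nbhs_ballP [d /= d0 hd] := cf _ (nbhsx_ballx (f z : K^o) _ e0).
exists d => // w hw; have := hd w.
by rewrite /ball /= distrC => /(_ hw); rewrite /= distrC.
Qed.

(** The rules for sums, products and inverses come from the topology of [K^o] for an arbitrary
    [numFieldType]. Their statements mention only the order and the norm, which is how they are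
    carried over to [R[i]]. *)
Lemma eps_continuousD (K : numFieldType) (f g : K -> K) (z : K) :
  eps_continuous f z -> eps_continuous g z ->
  eps_continuous (fun w => f w + g w) z.
Proof.
move=> /eps_continuousP cf /eps_continuousP cg; apply/eps_continuousP.
exact: (@continuousD K K^o K^o).
Qed.

Lemma eps_continuousM (K : numFieldType) (f g : K -> K) (z : K) :
  eps_continuous f z -> eps_continuous g z ->
  eps_continuous (fun w => f w * g w) z.
Proof.
move=> /eps_continuousP cf /eps_continuousP cg; apply/eps_continuousP.
exact: (@continuousM K K^o).
Qed.

Lemma eps_continuousV (K : numFieldType) (f : K -> K) (z : K) :
  f z != 0 -> eps_continuous f z -> eps_continuous (fun w => (f w)^-1) z.
Proof.
move=> f0 /eps_continuousP cf; apply/eps_continuousP.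
exact: (@continuousV K K^o).
Qed.

Section Complex.
Variable R : realType.
Local Notation C := R[i].
Local Notation Re := complex.Re.
Local Notation Im := complex.Im.
Implicit Types (x y z v : C) (f g : C -> C).

Lemma Re_add x y : Re (x + y) = Re x + Re y. Proof. by case: x; case: y. Qed.
Lemma Im_add x y : Im (x + y) = Im x + Im y. Proof. by case: x; case: y. Qed.
Lemma Re_mul x y : Re (x * y) = Re x * Re y - Im x * Im y.
Proof. by case: x; case: y. Qed.
Lemma Im_mul x y : Im (x * y) = Re x * Im y + Im x * Re y.
Proof. by case: x; case: y. Qed.

Lemma Re_opp x : Re (- x) = - Re x. Proof. by case: x. Qed.
Lemma Im_opp x : Im (- x) = - Im x. Proof. by case: x. Qed.

Lemma Re_sub x y : Re (x - y) = Re x - Re y. Proof. by case: x; case: y. Qed.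
Lemma Im_sub x y : Im (x - y) = Im x - Im y. Proof. by case: x; case: y. Qed.

Lemma conjcD x y : (x + y)^*%C = x^*%C + y^*%C. Proof. exact: rmorphD. Qed.
Lemma conjcB x y : (x - y)^*%C = x^*%C - y^*%C. Proof. exact: rmorphB. Qed.
Lemma conjcM x y : (x * y)^*%C = x^*%C * y^*%C. Proof. exact: rmorphM. Qed.

Lemma normc_lt_Re_Im (x : C) (e : R) :
  `|Re x| < e / 2 -> `|Im x| < e / 2 -> `|x| < e%:C.
Proof.
move=> hr hi; rewrite [x]complexE.
apply: (le_lt_trans (ler_normD _ _)).
rewrite normrM.
have -> : `|'i%C| = 1 :> C by rewrite normc_def /= expr0n expr1n add0r sqrtr1.
have n0 (a : R) : `|a%:C| = `|a|%:C.
  by rewrite normc_def /= expr0n addr0 sqrtr_sqr.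
by rewrite mul1r !n0 -rmorphD ltcR (splitr e) ltrD.
Qed.

Lemma normr_Re_lt x (e : R) : `|x| < e%:C -> `|Re x| < e.
Proof. by move=> h; rewrite -ltcR; exact: le_lt_trans (normc_ge_Re _) h. Qed.

Lemma normr_Im_lt x (e : R) : `|x| < e%:C -> `|Im x| < e.
Proof.
move=> h.
have -> : Im x = - Re (x * 'i%C) by rewrite ReiNIm opprK.
rewrite normrN; apply: normr_Re_lt; rewrite normrM.
have -> : `|'i%C| = 1 :> C by rewrite normc_def /= expr0n expr1n add0r sqrtr1.
by rewrite mulr1.
Qed.

Lemma posC (e : C) : 0 < e -> exists2 r : R, 0 < r & e = r%:C.
Proof. by case: e => a b; rewrite ltcE /= => /andP[/eqP -> h]; exists a. Qed.

(** Balls of [C^o] have radii in [C], but a positive complex number is real, so estimates can be run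
    with radii in [R]. *)
Lemma nbhsCP (z : C) (P : set C) :
  nbhs (z : C^o) (P : set C^o) <->
  exists2 d : R, 0 < d & forall w, `|w - z| < d%:C -> P w.
Proof.
split.
  move=> /nbhs_ballP [e /= e0 h].
  have [r r0 er] := posC e0.
  exists r => // w hw; apply: h.
  by rewrite /ball /= distrC er.
move=> [d d0 h]; apply/nbhs_ballP; exists d%:C => /=; first by rewrite ltcR.
by move=> w; rewrite /ball /= distrC => /h.
Qed.

Lemma openCP (D : set C) : Defs.openC D -> forall z, D z ->
  exists2 d : R, 0 < d & forall w, `|w - z| < d%:C -> D w.
Proof.
move=> oD z Dz; apply/nbhsCP.
by move: oD; rewrite /Defs.openC openE => /(_ z Dz).
Qed.

Lemma contCP f z : {for z, continuous (f : C^o -> C^o)} <->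
  forall e : R, 0 < e -> exists2 d : R, 0 < d &
    forall w, `|w - z| < d%:C -> `|f w - f z| < e%:C.
Proof.
split.
  move=> cf e e0.
  have ne : nbhs (f z : C^o) [set y : C^o | `|y - f z| < e%:C].
    by apply/nbhsCP; exists e.
  exact: (iffLR (nbhsCP _ _) (cf _ ne)).
move=> h A nA; have [e e0 hA] := iffLR (nbhsCP _ _) nA.
have [d d0 hd] := h e e0.
by apply/nbhsCP; exists d => // w /hd /hA.
Qed.

Lemma contC_Re f z : {for z, continuous (f : C^o -> C^o)} ->
  {for z, continuous ((fun w => Re (f w)) : C^o -> R)}.
Proof.
move=> /contCP cf A /nbhs_ballP [e /= e0 hA].
have [d d0 hd] := cf e e0.
apply/nbhsCP; exists d => // w /hd h; apply: hA.
by rewrite /ball /= distrC -Re_opp -Re_add; exact: normr_Re_lt.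
Qed.

Lemma contC_real (f : C^o -> R) (z : C) : {for z, continuous f} ->
  {for z, continuous ((fun w => (f w)%:C) : C^o -> C^o)}.
Proof.
move=> cf; apply/contCP => e e0.
have e20 : 0 < e / 2 by rewrite divr_gt0.
have [d d0 hd] := iffLR (nbhsCP _ _) (cf _ (nbhsx_ballx (f z) _ e20)).
exists d => // w /hd; rewrite /= /ball /= distrC => h.
rewrite -rmorphB; apply: normc_lt_Re_Im => //=.
by rewrite normr0 divr_gt0.
Qed.

Lemma contC_eps f z :
  {for z, continuous (f : C^o -> C^o)} <-> eps_continuous f z.
Proof.
split=> [/contCP cf e /posC [r r0 ->]|cf].
  by have [d d0 hd] := cf r r0; exists d%:C; rewrite ?ltcR.
apply/contCP => e e0; have [|_ /posC [d d0 ->] hd] := cf e%:C.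
  by rewrite ltcR.
by exists d.
Qed.

Lemma contCD f g z : {for z, continuous (f : C^o -> C^o)} ->
  {for z, continuous (g : C^o -> C^o)} ->
  {for z, continuous ((fun w => f w + g w) : C^o -> C^o)}.
Proof.
by move=> /contC_eps cf /contC_eps cg; apply/contC_eps/eps_continuousD.
Qed.

Lemma contCM f g z : {for z, continuous (f : C^o -> C^o)} ->
  {for z, continuous (g : C^o -> C^o)} ->
  {for z, continuous ((fun w => f w * g w) : C^o -> C^o)}.
Proof.
by move=> /contC_eps cf /contC_eps cg; apply/contC_eps/eps_continuousM.
Qed.

Lemma contCV f z : f z != 0 -> {for z, continuous (f : C^o -> C^o)} ->
  {for z, continuous ((fun w => (f w)^-1) : C^o -> C^o)}.
Proof.
by move=> f0 /contC_eps cf; apply/contC_eps/eps_continuousV.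
Qed.

Lemma contC_conj f z : {for z, continuous (f : C^o -> C^o)} ->
  {for z, continuous ((fun w => (f w)^*%C) : C^o -> C^o)}.
Proof.
move=> /contCP cf; apply/contCP => e /cf [d d0 hd]; exists d => // w /hd.
by rewrite -rmorphB normcJ.
Qed.

End Complex.

(** * Directional derivatives *)

Section DirectionalDerivatives.
Variable R : realType.
Local Notation C := R[i].
Local Notation Re := complex.Re.
Local Notation Im := complex.Im.
Implicit Types (x y z v : C) (f g : C -> C) (D : set C).

(** Relational counterpart of [pderivable] and [pderiv]: existence and value of the derivative pass
    together through the calculus rules. *)
Definition has_pd v f z d : Prop :=
  is_derive (0 : R) 1 (fun t : R => Re (f (z + v * t%:C))) (Re d) /\
  is_derive (0 : R) 1 (fun t : R => Im (f (z + v * t%:C))) (Im d).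

Lemma is_derive1P (g : R -> R) (x d : R) :
  is_derive x 1 g d <-> derivable g x 1 /\ derive1 g x = d.
Proof. by rewrite derive1E; split=> [[]|[]]. Qed.

Lemma has_pdP v f z d :
  has_pd v f z d <-> pderivable v f z /\ pderiv v f z = d.
Proof.
split=> [[/is_derive1P[a b] /is_derive1P[a' b']]|[[a b] <-]].
  split; first exact: conj a a'.
  by rewrite /pderiv b b'; case: (d).
split.
  exact: (iffRL (is_derive1P _ _ _) (conj a erefl)).
exact: (iffRL (is_derive1P _ _ _) (conj b erefl)).
Qed.

Lemma pderivableP v f z : pderivable v f z -> has_pd v f z (pderiv v f z).
Proof. by move=> h; apply/has_pdP. Qed.

Lemma near_line D z v : Defs.openC D -> D z ->
  \forall t \near (0 : R), D (z + v * t%:C).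
Proof.
move=> oD Dz; have [d d0 hd] := openCP oD Dz.
have [r r0 er] : exists2 r : R, 0 <= r & `|v| = r%:C.
  exists (Num.sqrt (Re v ^+ 2 + Im v ^+ 2)); rewrite ?sqrtr_ge0 //.
  exact: normc_def.
(* The radius is divided by [r + 1] rather than by [r], because the direction [v] may be 0. *)
have r10 : 0 < r + 1 by rewrite ltr_wpDl.
apply/nbhs_ballP; exists (d / (r + 1)); first by rewrite /= divr_gt0.
move=> t; rewrite /ball /= sub0r normrN => ht; apply: hd.
rewrite addrC addKr normrM er.
have -> : `|t%:C| = `|t|%:C.
  by rewrite normc_def /= expr0n addr0 sqrtr_sqr.
rewrite -rmorphM ltcR.
apply: (@le_lt_trans _ _ ((r + 1) * `|t|)).
  by rewrite ler_wpM2r // lerDl.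
by rewrite mulrC -ltr_pdivlMr.
Qed.

Lemma is_derive_near (f g : R -> R) (x d : R) :
  (\forall t \near x, f t = g t) -> is_derive x 1 f d -> is_derive x 1 g d.
Proof.
move=> fg [df <-]; split; last by apply/esym/near_eq_derive.
exact: (near_eq_derivable fg).
Qed.

Lemma has_pd_eq D v f g z d : Defs.openC D -> D z ->
  (forall w, D w -> f w = g w) -> has_pd v f z d -> has_pd v g z d.
Proof.
move=> oD Dz fg [hr hi]; split.
  by apply: is_derive_near hr; have := near_line v oD Dz; apply: filterS => t /fg ->.
by apply: is_derive_near hi; have := near_line v oD Dz; apply: filterS => t /fg ->.
Qed.

Lemma has_pd_cst v c z : has_pd v (fun=> c) z 0.
Proof. by split; exact: is_derive_cst. Qed.

Lemma has_pdD v f g z df dg : has_pd v f z df -> has_pd v g z dg ->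
  has_pd v (fun w => f w + g w) z (df + dg).
Proof.
move=> [f1 f2] [g1 g2]; split.
  rewrite Re_add; under eq_fun do rewrite Re_add.
  exact: is_deriveD.
rewrite Im_add; under eq_fun do rewrite Im_add.
exact: is_deriveD.
Qed.

Lemma has_pdM v f g z df dg : has_pd v f z df -> has_pd v g z dg ->
  has_pd v (fun w => f w * g w) z (df * g z + f z * dg).
Proof.
move=> [f1 f2] [g1 g2].
split.
  under eq_fun do rewrite Re_mul.
  apply: is_derive_eq (is_deriveB (is_deriveM f1 g1) (is_deriveM f2 g2)) _.
  by rewrite mulr0 addr0 Re_add !Re_mul /GRing.scale /=; ring.
under eq_fun do rewrite Im_mul.
apply: is_derive_eq (is_deriveD (is_deriveM f1 g2) (is_deriveM f2 g1)) _.
by rewrite mulr0 addr0 Im_add !Im_mul /GRing.scale /=; ring.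
Qed.

Lemma Re_conj x : Re x^*%C = Re x. Proof. by case: x. Qed.
Lemma Im_conj x : Im x^*%C = - Im x. Proof. by case: x. Qed.

Lemma has_pd_conj v f z df : has_pd v f z df ->
  has_pd v (fun w => (f w)^*%C) z df^*%C.
Proof.
move=> [f1 f2]; split.
  by rewrite Re_conj; under eq_fun do rewrite Re_conj.
by rewrite Im_conj; under eq_fun do rewrite Im_conj; exact: is_deriveN.
Qed.

(** Along a real line this is a statement about the two real quotients Re f / |f|^2 and -Im f /
    |f|^2; [q] is the common denominator. *)
Lemma has_pdV v f z df : f z != 0 -> has_pd v f z df ->
  has_pd v (fun w => (f w)^-1) z (- df * (f z)^-1 * (f z)^-1).
Proof.
move=> f0 [f1 f2].
have q0 : Re (f z) ^+ 2 + Im (f z) ^+ 2 != 0.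
  by apply: contra f0; rewrite eq_complex /= paddr_eq0 ?sqr_ge0 ?sqrf_eq0.
have z0 : z + v * 0%:C = z by rewrite mulr0 addr0.
pose q (t : R) : R := Re (f (z + v * t%:C)) ^+ 2 + Im (f (z + v * t%:C)) ^+ 2.
have qd : is_derive (0 : R) 1 q (2 * (Re (f z) * Re df + Im (f z) * Im df)).
  apply: is_derive_eq (is_deriveD (is_deriveM f1 f1) (is_deriveM f2 f2)) _.
  by rewrite z0 /GRing.scale /=; ring.
have q0' : q 0 != 0 by rewrite /q z0.
have qi := is_deriveV q0' qd.
have reV x : Re x^-1 = Re x * (Re x ^+ 2 + Im x ^+ 2)^-1 by case: x.
have imV x : Im x^-1 = - (Im x * (Re x ^+ 2 + Im x ^+ 2)^-1).
  by case: x.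
split.
  under eq_fun do rewrite reV.
  apply: is_derive_eq (is_deriveM f1 qi) _.
  rewrite /q z0 !Re_mul !Im_mul Re_opp Im_opp reV imV /GRing.scale /=.
  by field.
under eq_fun do rewrite imV.
apply: is_derive_eq (is_deriveN (is_deriveM f2 qi)) _.
rewrite /q z0 !Im_mul !Re_mul Re_opp Im_opp reV imV /GRing.scale /=.
by field.
Qed.

Lemma has_pd_ln v f z df : 0 < f z -> has_pd v f z df ->
  has_pd v (fun w => (- ln (Re (f w)))%:C) z (- (Re df / Re (f z))%:C).
Proof.
move=> f0 [f1 _]; split; last by rewrite -rmorphN; exact: is_derive_cst.
rewrite -rmorphN /=.
have z0 : z + v * 0%:C = z by rewrite mulr0 addr0.
have f0' : 0 < Re (f (z + v * 0%:C)) by rewrite z0; move: f0; rewrite ltcE => /andP[].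
have := is_deriveN (is_derive1_comp (is_derive1_ln f0') f1).
by rewrite z0 mulrC.
Qed.

End DirectionalDerivatives.

(** * Smooth functions and Wirtinger derivatives *)

Section SmoothFunctions.
Variable R : realType.
Local Notation C := R[i].
Variable D : set C.
Hypothesis oD : Defs.openC D.
Implicit Types (z v c : C) (f g : C -> C) (k : nat).

Lemma Ck0P f : Ck 0 D f <->
  forall z, D z -> {for z, continuous (f : C^o -> C^o)}.
Proof. by split=> [[]|h]; [|exact: conj h I]. Qed.

Lemma Ck0_eq f g : (forall z, D z -> f z = g z) -> Ck 0 D f -> Ck 0 D g.
Proof.
move=> fg /Ck0P cf; apply/Ck0P => z Dz; apply/contCP => e e0.
have [d d0 hd] := iffLR (contCP _ _) (cf z Dz) e e0.
have [d' d'0 hd'] := openCP oD Dz.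
exists (Num.min d d'); first by rewrite lt_min d0.
move=> w hw; rewrite -!fg //; first apply: hd.
  by apply: (lt_le_trans hw); rewrite lecR ge_min lexx.
by apply: hd'; apply: (lt_le_trans hw); rewrite lecR ge_min lexx orbT.
Qed.

Lemma pderiv_eq v f g z : (forall z, D z -> f z = g z) -> D z ->
  pderivable v f z -> pderivable v g z /\ pderiv v g z = pderiv v f z.
Proof. by move=> fg Dz /pderivableP pf; apply/has_pdP/(has_pd_eq oD Dz fg). Qed.

Lemma Ck_eq k f g : (forall z, D z -> f z = g z) -> Ck k D f -> Ck k D g.
Proof.
elim: k f g => [|k IH] f g fg; first exact: Ck0_eq.
move=> [cf [pf f1 fi]].
have /Ck0P cg : Ck 0 D g by apply: (Ck0_eq fg); apply/Ck0P.
split; [exact: cg|split].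
- move=> z Dz; have [p1 pi] := pf z Dz.
  by split; [apply: (pderiv_eq fg Dz p1).1|apply: (pderiv_eq fg Dz pi).1].
- by apply: IH f1 => z Dz; apply/esym/(pderiv_eq fg Dz (pf z Dz).1).2.
- by apply: IH fi => z Dz; apply/esym/(pderiv_eq fg Dz (pf z Dz).2).2.
Qed.

(** Lets the partial derivatives be supplied by formulas valid on [D], whereas [Ck] recurses on
    [pderiv] itself. The closure properties below then follow by induction on [k]. *)
Lemma CkS k f f1 fi : (forall z, D z -> {for z, continuous (f : C^o -> C^o)}) ->
  (forall z, D z -> has_pd 1 f z (f1 z) /\ has_pd 'i%C f z (fi z)) ->
  Ck k D f1 -> Ck k D fi -> Ck k.+1 D f.
Proof.
move=> cf pf h1 hi; split; [exact: cf|split].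
- by move=> z /pf[/has_pdP[p1 _] /has_pdP[pi _]]; exact: conj p1 pi.
- by apply: Ck_eq h1 => z /pf[/has_pdP[_ ->]].
- by apply: Ck_eq hi => z /pf[_ /has_pdP[_ ->]].
Qed.

Lemma CkW k f : Ck k.+1 D f -> Ck k D f.
Proof.
elim: k f => [|k IH] f [cf [pf f1 fi]]; first exact/Ck0P.
exact: (conj cf (And3 pf (IH _ f1) (IH _ fi))).
Qed.

Lemma Ck_cst k c : Ck k D (fun=> c).
Proof.
elim: k c => [|k IH] c; first by apply/Ck0P => z _; exact: cst_continuous.
apply: CkS (IH 0) (IH 0) => z _; first exact: cst_continuous.
by split; exact: has_pd_cst.
Qed.

Lemma CkD k f g : Ck k D f -> Ck k D g -> Ck k D (fun z => f z + g z).
Proof.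
elim: k f g => [|k IH] f g [cf hf] [cg hg].
  by apply/Ck0P => z Dz; apply: contCD; [exact: cf|exact: cg].
case: hf hg => pf f1 fi [pg g1 gi].
apply: CkS (IH _ _ f1 g1) (IH _ _ fi gi) => z Dz.
  by apply: contCD; [exact: cf|exact: cg].
have [/pderivableP ? /pderivableP ?] := pf z Dz.
have [/pderivableP ? /pderivableP ?] := pg z Dz.
by split; exact: has_pdD.
Qed.

Lemma CkM k f g : Ck k D f -> Ck k D g -> Ck k D (fun z => f z * g z).
Proof.
elim: k f g => [|k IH] f g hf hg.
  case: hf hg => cf _ [cg _].
  by apply/Ck0P => z Dz; apply: contCM; [exact: cf|exact: cg].
(* The product rule involves f and g next to their derivatives, so both are also needed at the lower
   order. *)
have [hf' hg'] := (CkW hf, CkW hg).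
case: hf hg => cf [pf f1 fi] [cg [pg g1 gi]].
apply: CkS (CkD (IH _ _ f1 hg') (IH _ _ hf' g1))
           (CkD (IH _ _ fi hg') (IH _ _ hf' gi)) => z Dz.
  by apply: contCM; [exact: cf|exact: cg].
have [/pderivableP ? /pderivableP ?] := pf z Dz.
have [/pderivableP ? /pderivableP ?] := pg z Dz.
by split; exact: has_pdM.
Qed.

Lemma Ck_conj k f : Ck k D f -> Ck k D (fun z => (f z)^*%C).
Proof.
elim: k f => [|k IH] f [cf hf].
  by apply/Ck0P => z Dz; apply: contC_conj; exact: cf.
case: hf => pf f1 fi; apply: CkS (IH _ f1) (IH _ fi) => z Dz.
  by apply: contC_conj; exact: cf.
have [/pderivableP ? /pderivableP ?] := pf z Dz.
by split; exact: has_pd_conj.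
Qed.

Lemma CkV k f : (forall z, D z -> f z != 0) -> Ck k D f ->
  Ck k D (fun z => (f z)^-1).
Proof.
move=> f0; elim: k => [|k IH] hf.
  case: hf => cf _.
  by apply/Ck0P => z Dz; apply: contCV; [exact: f0|exact: cf].
have hV := IH (CkW hf).
case: hf => cf [pf f1 fi].
have hN g : Ck k D g -> Ck k D (fun z => - g z * (f z)^-1 * (f z)^-1).
  move=> hg; apply: CkM (hV); apply: CkM (hV).
  by apply: Ck_eq (CkM (Ck_cst k (- 1)) hg) => z _; rewrite mulN1r.
apply: CkS (hN _ f1) (hN _ fi) => z Dz.
  by apply: contCV; [exact: f0|exact: cf].
have [/pderivableP ? /pderivableP ?] := pf z Dz.
by split; apply: has_pdV; rewrite ?f0.
Qed.

Lemma smooth_eq f g : (forall z, D z -> f z = g z) -> smooth D f -> smooth D g.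
Proof. by move=> fg hf k; exact: Ck_eq fg (hf k). Qed.

Lemma smooth_cst c : smooth D (fun=> c).
Proof. by move=> k; exact: Ck_cst. Qed.

Lemma smoothD f g : smooth D f -> smooth D g -> smooth D (fun z => f z + g z).
Proof. by move=> hf hg k; exact: CkD. Qed.

Lemma smoothM f g : smooth D f -> smooth D g -> smooth D (fun z => f z * g z).
Proof. by move=> hf hg k; exact: CkM. Qed.

Lemma smoothN f : smooth D f -> smooth D (fun z => - f z).
Proof.
move=> hf; apply: smooth_eq (smoothM (smooth_cst (-1)) hf) => z _.
by rewrite mulN1r.
Qed.

Lemma smooth_conj f : smooth D f -> smooth D (fun z => (f z)^*%C).
Proof. by move=> hf k; exact: Ck_conj. Qed.

Lemma smoothV f : (forall z, D z -> f z != 0) -> smooth D f ->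
  smooth D (fun z => (f z)^-1).
Proof. by move=> f0 hf k; exact: CkV. Qed.

Lemma smooth_sum (I : Type) (r : seq I) (F : I -> C -> C) :
  (forall i, smooth D (F i)) -> smooth D (fun z => \sum_(i <- r) F i z).
Proof.
move=> hF; elim: r => [|i r IH].
  by apply: smooth_eq (smooth_cst 0) => z _; rewrite big_nil.
by apply: smooth_eq (smoothD (hF i) IH) => z _; rewrite big_cons.
Qed.

Lemma smooth_continuous f z : smooth D f -> D z ->
  {for z, continuous (f : C^o -> C^o)}.
Proof. by move=> /(_ 0)[cf _]; exact: cf. Qed.

Lemma smooth_has_pd f z : smooth D f -> D z ->
  has_pd 1 f z (pderiv 1 f z) /\ has_pd 'i%C f z (pderiv 'i%C f z).
Proof.
by move=> /(_ 1)[_ [pf _ _]] /pf [/pderivableP ? /pderivableP ?].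
Qed.

Lemma smooth_pderiv f : smooth D f ->
  smooth D (pderiv 1 f) /\ smooth D (pderiv 'i%C f).
Proof. by move=> hf; split=> k; have [_ [_ ? ?]] := hf k.+1. Qed.

Lemma smooth_du f : smooth D f -> smooth D (du f).
Proof.
move=> /smooth_pderiv[h1 hi]; apply: smoothM (smooth_cst _).
by apply: (smoothD h1); apply/smoothN/smoothM => //; exact: smooth_cst.
Qed.

Lemma smooth_dub f : smooth D f -> smooth D (dub f).
Proof.
move=> /smooth_pderiv[h1 hi]; apply: smoothM (smooth_cst _).
by apply: (smoothD h1); apply: smoothM => //; exact: smooth_cst.
Qed.

Lemma smoothS f f1 fi :
  (forall z, D z -> {for z, continuous (f : C^o -> C^o)}) ->
  (forall z, D z -> has_pd 1 f z (f1 z) /\ has_pd 'i%C f z (fi z)) ->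
  smooth D f1 -> smooth D fi -> smooth D f.
Proof.
move=> cf pf h1 hi [|k]; first exact/Ck0P.
exact: CkS (h1 k) (hi k).
Qed.

Lemma pos_Re x : 0 < x :> C -> (complex.Re x)%:C = x /\ 0 < complex.Re x.
Proof. by move=> /posC [r r0 ->]. Qed.

Lemma has_pd_real v f z df : (forall w, D w -> f w \is Num.real) -> D z ->
  has_pd v f z df -> df \is Num.real.
Proof.
move=> fr Dz hf.
(* On [D] the function equals its conjugate, so by uniqueness its derivative is self-conjugate. *)
have hc : has_pd v f z df^*%C.
  apply: (@has_pd_eq _ D v (fun w => (f w)^*%C)) (has_pd_conj hf) => // w Dw.
  by have /complex_realP[r ->] := fr w Dw; rewrite conjc_real.
have /has_pdP[_ h1] := hf; have /has_pdP[_ h2] := hc.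
case: df {hf hc} h1 h2 => a b -> [] /eqP; rewrite -addr_eq0 -mulr2n.
by rewrite mulrn_eq0 /= complex_real.
Qed.

Lemma has_pd_lnRe v f z df : (forall w, D w -> 0 < f w) -> D z ->
  has_pd v f z df ->
  has_pd v (fun w => (- ln (complex.Re (f w)))%:C) z (- df * (f z)^-1).
Proof.
move=> f0 Dz hf.
have fr w : D w -> f w \is Num.real by move=> /f0 /gtr0_real.
have [ef _] := pos_Re (f0 z Dz).
have := has_pd_ln (f0 z Dz) hf.
have /RRe_real e := has_pd_real fr Dz hf.
suff -> : (complex.Re df / complex.Re (f z))%:C = df / f z by rewrite mulNr.
by rewrite -{2}e -{2}ef rmorphM fmorphV.
Qed.

Lemma smooth_lnRe f : (forall w, D w -> 0 < f w) -> smooth D f ->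
  smooth D (fun w => (- ln (complex.Re (f w)))%:C).
Proof.
move=> f0 hf; have [h1 hi] := smooth_pderiv hf.
have hV : smooth D (fun w => (f w)^-1).
  by apply: smoothV => // z /f0; rewrite lt0r => /andP[].
apply: (@smoothS _ (fun z => - pderiv 1 f z * (f z)^-1)
                   (fun z => - pderiv 'i%C f z * (f z)^-1)).
- move=> z Dz; apply: contC_real.
  have cf := contC_Re (smooth_continuous hf Dz).
  have [_ r0] := pos_Re (f0 z Dz).
  apply: (@continuousN _ R^o C^o).
  exact: (continuous_comp cf (continuous_ln r0)).
- by move=> z Dz; have [? ?] := smooth_has_pd hf Dz; split; exact: has_pd_lnRe.
- by apply: smoothM hV; exact: smoothN.
- by apply: smoothM hV; exact: smoothN.
Qed.

Lemma du_pd f z a b : has_pd 1 f z a -> has_pd 'i%C f z b ->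
  du f z = (a - 'i%C * b) / 2 /\ dub f z = (a + 'i%C * b) / 2.
Proof. by move=> /has_pdP[_ h1] /has_pdP[_ hi]; rewrite /du /dub h1 hi. Qed.

Lemma du_eq f g z : (forall w, D w -> f w = g w) -> D z -> smooth D f ->
  du f z = du g z /\ dub f z = dub g z.
Proof.
move=> fg Dz hf; have [h1 hi] := smooth_has_pd hf Dz.
have [-> ->] := du_pd h1 hi.
by have [-> ->] := du_pd (has_pd_eq oD Dz fg h1) (has_pd_eq oD Dz fg hi).
Qed.

Lemma du_cst c z : du (fun=> c : C) z = 0 /\ dub (fun=> c : C) z = 0.
Proof.
have [-> ->] := du_pd (has_pd_cst 1 c z) (has_pd_cst 'i%C c z).
by rewrite mulr0 subr0 addr0 mul0r.
Qed.

Lemma du_add f g z : smooth D f -> smooth D g -> D z ->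
  du (fun w => f w + g w) z = du f z + du g z /\
  dub (fun w => f w + g w) z = dub f z + dub g z.
Proof.
move=> hf hg Dz.
have [f1 fi] := smooth_has_pd hf Dz; have [g1 gi] := smooth_has_pd hg Dz.
have [-> ->] := du_pd (has_pdD f1 g1) (has_pdD fi gi).
by rewrite /du /dub; split; ring.
Qed.

Lemma du_mul f g z : smooth D f -> smooth D g -> D z ->
  du (fun w => f w * g w) z = du f z * g z + f z * du g z /\
  dub (fun w => f w * g w) z = dub f z * g z + f z * dub g z.
Proof.
move=> hf hg Dz.
have [f1 fi] := smooth_has_pd hf Dz; have [g1 gi] := smooth_has_pd hg Dz.
have [-> ->] := du_pd (has_pdM f1 g1) (has_pdM fi gi).
by rewrite /du /dub; split; ring.
Qed.

Lemma du_inv f z : f z != 0 -> smooth D f -> D z ->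
  du (fun w => (f w)^-1) z = - du f z * (f z)^-1 * (f z)^-1 /\
  dub (fun w => (f w)^-1) z = - dub f z * (f z)^-1 * (f z)^-1.
Proof.
move=> f0 hf Dz; have [f1 fi] := smooth_has_pd hf Dz.
have [-> ->] := du_pd (has_pdV f0 f1) (has_pdV f0 fi).
by rewrite /du /dub; split; ring.
Qed.

Lemma du_conjc f z : smooth D f -> D z ->
  du (fun w => (f w)^*%C) z = (dub f z)^*%C /\ dub (fun w => (f w)^*%C) z = (du f z)^*%C.
Proof.
move=> hf Dz; have [f1 fi] := smooth_has_pd hf Dz.
have [-> ->] := du_pd (has_pd_conj f1) (has_pd_conj fi).
have ci : ('i%C : C)^*%C = - 'i%C by apply/eqP; rewrite eq_complex /= oppr0 !eqxx.
have c2 : ((2 : C)^-1)^*%C = 2^-1 by rewrite conjc_inv conjc_nat.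
split; rewrite /du /dub conjcM c2; congr (_ * _).
  by rewrite conjcD conjcM ci mulNr.
by rewrite conjcB conjcM ci mulNr opprK.
Qed.

Lemma du_lnRe f z : (forall w, D w -> 0 < f w) -> smooth D f -> D z ->
  du (fun w => (- ln (complex.Re (f w)))%:C) z = - du f z * (f z)^-1 /\
  dub (fun w => (- ln (complex.Re (f w)))%:C) z = - dub f z * (f z)^-1.
Proof.
move=> f0 hf Dz; have [f1 fi] := smooth_has_pd hf Dz.
have [-> ->] := du_pd (has_pd_lnRe f0 Dz f1) (has_pd_lnRe f0 Dz fi).
by rewrite /du /dub; split; ring.
Qed.

End SmoothFunctions.

(** * Symmetry of mixed derivatives *)

Section Schwarz.
Variable R : realType.
Local Notation C := R[i].
Local Notation Re := complex.Re.
Local Notation Im := complex.Im.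

Lemma is_derive_shift (g : R -> R) (s d : R) :
  is_derive (0 : R) 1 (fun t => g (s + t)) d -> is_derive s 1 g d.
Proof.
move=> hg.
have hs : is_derive s 1 (fun x : R => x - s) 1.
  apply: is_derive_eq (is_deriveB (is_derive_id _ _) (is_derive_cst _ _ _)) _.
  by rewrite subr0.
have hg' : is_derive (s - s) 1 (fun t => g (s + t)) d by rewrite subrr.
have := @is_derive1_comp _ (fun t => g (s + t)) (fun x => x - s) s d 1 hg' hs.
rewrite mulr1 (_ : _ \o _ = g) //; apply/funext => x /=.
by rewrite addrC subrK.
Qed.

(** The mean value theorem used twice: for x -> F x h - F x 0, which yields s, then for [F1 s],
    which yields t. *)
Lemma second_difference (F F1 F12 : R -> R -> R) (e h : R) : 0 < h < e ->
  (forall s t : R, `|s| < e -> `|t| < e -> is_derive s 1 (F ^~ t) (F1 s t)) ->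
  (forall s t : R, `|s| < e -> `|t| < e -> is_derive t 1 (F1 s) (F12 s t)) ->
  exists s t : R, [/\ `|s| <= h, `|t| <= h
    & F h h - F h 0 - (F 0 h - F 0 0) = F12 s t * h ^+ 2].
Proof.
move=> /andP[h0 he] d1 d12.
have hin (s : R) : s \in `[0, h] -> `|s| < e.
  by rewrite in_itv /= => /andP[s0 sh]; rewrite ger0_norm // (le_lt_trans sh).
have hin' (s : R) : s \in `[0, h] -> `|s| <= h.
  by rewrite in_itv /= => /andP[s0 sh]; rewrite ger0_norm.
have oc (s : R) : s \in `]0, h[ -> s \in `[0, h] by apply: subset_itv_oo_cc.
have h_in : h \in `[0, h] by rewrite in_itv /= ltW ?lexx.
have o_in : 0 \in `[0, h] by rewrite in_itv /= lexx ltW.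
have dphi (s : R) : s \in `[0, h] ->
    is_derive s 1 (fun x => F x h - F x 0) (F1 s h - F1 s 0).
  by move=> sh; apply: is_deriveB; apply: d1; rewrite hin.
have cphi : {within `[0, h], continuous (fun x => F x h - F x 0)}.
  by apply: derivable_within_continuous => x /dphi [].
have [s sh es] := MVT h0 (fun x hx => dphi x (oc x hx)) cphi.
have dpsi (t : R) : t \in `[0, h] -> is_derive t 1 (F1 s) (F12 s t).
  by move=> th; apply: d12; [exact: hin (oc _ sh)|exact: hin].
have cpsi : {within `[0, h], continuous (F1 s)}.
  by apply: derivable_within_continuous => x /dpsi [].
have [t th et] := MVT h0 (fun x hx => dpsi x (oc x hx)) cpsi.
exists s, t; split; [exact: hin' (oc _ sh)|exact: hin' (oc _ th)|].
by rewrite es et !subr0 -mulrA.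
Qed.

(* The second difference of F over a square is symmetric in s and t, so it
   approximates both mixed derivatives. *)
Lemma mixed_derivatives (F F1 F2 F12 F21 : R -> R -> R) (e : R) : 0 < e ->
  (forall s t : R, `|s| < e -> `|t| < e -> is_derive s 1 (F ^~ t) (F1 s t)) ->
  (forall s t : R, `|s| < e -> `|t| < e -> is_derive t 1 (F1 s) (F12 s t)) ->
  (forall s t : R, `|s| < e -> `|t| < e -> is_derive t 1 (F s) (F2 s t)) ->
  (forall s t : R, `|s| < e -> `|t| < e -> is_derive s 1 (F2 ^~ t) (F21 s t)) ->
  (forall r, 0 < r -> exists2 d, 0 < d & forall s t : R, `|s| < d -> `|t| < d ->
     `|F12 s t - F12 0 0| < r /\ `|F21 s t - F21 0 0| < r) ->
  F12 0 0 = F21 0 0.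
Proof.
move=> e0 d1 d12 d2 d21 cF; apply/eqP; rewrite -subr_eq0 -normr_le0.
apply/ler_addgt0Pl => r r0; rewrite addr0.
have [d d0 hd] := cF (r / 2) (divr_gt0 r0 (ltr0Sn _ 1)).
pose h := Num.min d e / 2.
have m0 : 0 < Num.min d e by rewrite lt_min d0.
have h0 : 0 < h by rewrite divr_gt0.
have hm : h < Num.min d e by rewrite /h; lra.
have /andP[hd' he] : (h < d) && (h < e) by rewrite -lt_min.
have he' : 0 < h < e by rewrite h0.
have [s [t [s1 t1 e1]]] := second_difference he' d1 d12.
have [t' [s' [t2 s2 e2]]] := second_difference (F := fun t s => F s t)
  (F1 := fun t s => F2 s t) (F12 := fun t s => F21 s t) he'
  (fun t s ht hs => d2 s t hs ht) (fun t s ht hs => d21 s t hs ht).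
have e12 : F12 s t = F21 s' t'.
  apply: (@mulIf _ (h ^+ 2)); first by rewrite expf_neq0 // gt_eqF.
  by rewrite -e1 -e2; ring.
have [a1 _] := hd s t (le_lt_trans s1 hd') (le_lt_trans t1 hd').
have [_ a2] := hd s' t' (le_lt_trans s2 hd') (le_lt_trans t2 hd').
rewrite -e12 in a2.
have -> : F12 0 0 - F21 0 0 = (F12 s t - F21 0 0) - (F12 s t - F12 0 0) by ring.
by apply: (le_trans (ler_normB _ _)); rewrite (splitr r) ltW // ltrD.
Qed.

Variable D : set C.
Hypothesis oD : Defs.openC D.

(** The real theorem is applied separately to Re f and Im f in the coordinates (s, t) of the point z
    + s + i t; only continuity at z of the two mixed derivatives enters. *)
Lemma has_pd_comm (f f1 fi f1i fi1 : C -> C) z : D z ->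
  (forall w, D w -> has_pd 1 f w (f1 w) /\ has_pd 'i%C f w (fi w)) ->
  (forall w, D w -> has_pd 'i%C f1 w (f1i w)) ->
  (forall w, D w -> has_pd 1 fi w (fi1 w)) ->
  {for z, continuous (f1i : C^o -> C^o)} ->
  {for z, continuous (fi1 : C^o -> C^o)} -> f1i z = fi1 z.
Proof.
move=> Dz pf pf1 pfi /contCP c1i /contCP ci1.
have [d d0 hd] := openCP oD Dz.
pose pt (s t : R) : C := z + s%:C + 'i%C * t%:C.
have ptz : pt 0 0 = z by rewrite /pt mulr0 !addr0.
have near_pt (r s t : R) : `|s| < r / 2 -> `|t| < r / 2 -> `|pt s t - z| < r%:C.
  move=> hs ht; apply: normc_lt_Re_Im.
    suff -> : Re (pt s t - z) = s by [].
    by rewrite /pt; case: (z) => a b /=; ring.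
  suff -> : Im (pt s t - z) = t by [].
  by rewrite /pt; case: (z) => a b /=; ring.
have Dpt (s t : R) : `|s| < d / 2 -> `|t| < d / 2 -> D (pt s t).
  by move=> hs ht; apply: hd; exact: near_pt.
have d1 (g g' : C -> C) (s t : R) : has_pd 1 g (pt s t) (g' (pt s t)) ->
    is_derive s 1 (fun s => Re (g (pt s t))) (Re (g' (pt s t))) /\
    is_derive s 1 (fun s => Im (g (pt s t))) (Im (g' (pt s t))).
  move=> [r1 i1].
  have ept (u : R) : pt s t + 1 * u%:C = pt (s + u) t.
    by rewrite /pt rmorphD mul1r; ring.
  split; apply: is_derive_shift.
    by under eq_fun do rewrite -ept.
  by under eq_fun do rewrite -ept.
have d2 (g g' : C -> C) (s t : R) : has_pd 'i%C g (pt s t) (g' (pt s t)) ->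
    is_derive t 1 (fun t => Re (g (pt s t))) (Re (g' (pt s t))) /\
    is_derive t 1 (fun t => Im (g (pt s t))) (Im (g' (pt s t))).
  move=> [r1 i1].
  have ept (u : R) : pt s t + 'i%C * u%:C = pt s (t + u).
    by rewrite /pt rmorphD mulrDr addrA.
  split; apply: is_derive_shift.
    by under eq_fun do rewrite -ept.
  by under eq_fun do rewrite -ept.
have d20 : 0 < d / 2 by rewrite divr_gt0.
have cont (r : R) : 0 < r -> exists2 dd : R, 0 < dd &
    forall s t : R, `|s| < dd -> `|t| < dd ->
    `|f1i (pt s t) - f1i (pt 0 0)| < r%:C /\ `|fi1 (pt s t) - fi1 (pt 0 0)| < r%:C.
  move=> r0; rewrite ptz.
  have [a a0 ha] := c1i r r0; have [b b0 hb] := ci1 r r0.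
  exists (Num.min a b / 2); first by rewrite divr_gt0 // lt_min a0.
  move=> s t hs ht; have hst := near_pt _ _ _ hs ht.
  split; [apply: ha|apply: hb]; apply: (lt_le_trans hst); rewrite lecR ge_min lexx //.
  by rewrite orbT.
have eRe := @mixed_derivatives (fun s t => Re (f (pt s t)))
    (fun s t => Re (f1 (pt s t))) (fun s t => Re (fi (pt s t)))
    (fun s t => Re (f1i (pt s t))) (fun s t => Re (fi1 (pt s t))) (d / 2) d20
    (fun s t hs ht => (d1 f f1 s t (pf _ (Dpt s t hs ht)).1).1)
    (fun s t hs ht => (d2 f1 f1i s t (pf1 _ (Dpt s t hs ht))).1)
    (fun s t hs ht => (d2 f fi s t (pf _ (Dpt s t hs ht)).2).1)
    (fun s t hs ht => (d1 fi fi1 s t (pfi _ (Dpt s t hs ht))).1).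
have eIm := @mixed_derivatives (fun s t => Im (f (pt s t)))
    (fun s t => Im (f1 (pt s t))) (fun s t => Im (fi (pt s t)))
    (fun s t => Im (f1i (pt s t))) (fun s t => Im (fi1 (pt s t))) (d / 2) d20
    (fun s t hs ht => (d1 f f1 s t (pf _ (Dpt s t hs ht)).1).2)
    (fun s t hs ht => (d2 f1 f1i s t (pf1 _ (Dpt s t hs ht))).2)
    (fun s t hs ht => (d2 f fi s t (pf _ (Dpt s t hs ht)).2).2)
    (fun s t hs ht => (d1 fi fi1 s t (pfi _ (Dpt s t hs ht))).2).
rewrite -ptz; apply/eqP; rewrite eq_complex; apply/andP; split; apply/eqP.
  apply: eRe => r /cont [dd dd0 hdd]; exists dd => // s t hs ht.
  have [/normr_Re_lt u /normr_Re_lt v] := hdd s t hs ht.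
  by move: u v; rewrite !Re_sub; exact: conj.
apply: eIm => r /cont [dd dd0 hdd]; exists dd => // s t hs ht.
have [/normr_Im_lt u /normr_Im_lt v] := hdd s t hs ht.
by move: u v; rewrite !Im_sub; exact: conj.
Qed.

Lemma pderiv_comm (f : C -> C) z : smooth D f -> D z ->
  pderiv 'i%C (pderiv 1 f) z = pderiv 1 (pderiv 'i%C f) z.
Proof.
move=> hf Dz; have [h1 hi] := smooth_pderiv hf.
have [_ h1i] := smooth_pderiv h1; have [hi1 _] := smooth_pderiv hi.
apply: (has_pd_comm Dz (fun w => smooth_has_pd hf)
  (fun w Dw => (smooth_has_pd h1 Dw).2) (fun w Dw => (smooth_has_pd hi Dw).1)).
  exact: smooth_continuous h1i Dz.
exact: smooth_continuous hi1 Dz.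
Qed.

(** Both sides equal (a + c) / 4, a quarter of the Laplacian, because the same [b] serves as both
    mixed derivatives. *)
Lemma du_dub_pd (f1 fi : C -> C) z a b c : has_pd 1 f1 z a ->
  has_pd 'i%C f1 z b -> has_pd 1 fi z b -> has_pd 'i%C fi z c ->
  du (fun w => (f1 w + 'i%C * fi w) / 2) z = dub (fun w => (f1 w - 'i%C * fi w) / 2) z.
Proof.
move=> p11 p1i pi1 pii.
have cst v k : has_pd v (fun=> k : C) z 0 by exact: has_pd_cst.
have opp v g d : has_pd v g z d -> has_pd v (fun w => - g w) z (- d).
  move=> hg; have := has_pdM (cst v (-1)) hg; rewrite mul0r add0r mulN1r.
  by under eq_fun do rewrite mulN1r.
have [_ ->] := du_pd
  (has_pdM (has_pdD p11 (opp _ _ _ (has_pdM (cst _ 'i%C) pi1))) (cst _ 2^-1))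
  (has_pdM (has_pdD p1i (opp _ _ _ (has_pdM (cst _ 'i%C) pii))) (cst _ 2^-1)).
have [-> _] := du_pd
  (has_pdM (has_pdD p11 (has_pdM (cst _ 'i%C) pi1)) (cst _ 2^-1))
  (has_pdM (has_pdD p1i (has_pdM (cst _ 'i%C) pii)) (cst _ 2^-1)).
by ring.
Qed.

Lemma du_dub_comm (f : C -> C) z : smooth D f -> D z -> du (dub f) z = dub (du f) z.
Proof.
move=> hf Dz; have sch := pderiv_comm hf Dz.
have [h1 hi] := smooth_pderiv hf.
have [p11 p1i] := smooth_has_pd h1 Dz.
have [pi1 pii] := smooth_has_pd hi Dz.
by rewrite sch in p1i; exact: (du_dub_pd p11 p1i pi1 pii).
Qed.

(** Smoothness is part of holomorphy here, so commuting [dub] past [du] is all that has to be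
    done. *)
Lemma holomorphic_du (f : C -> C) : holomorphic D f -> holomorphic D (du f).
Proof.
move=> [hf f0]; split; first exact: (smooth_du oD hf).
move=> z Dz; rewrite -du_dub_comm //.
have [-> _] := du_eq oD f0 Dz (smooth_dub oD hf).
by have [] := du_cst (0 : C) z.
Qed.

End Schwarz.

(** * The cup product *)

Lemma gramK3_sym : gramK3^T = gramK3.
Proof.
have sU : gramU^T = gramU by apply/matrixP => i k; rewrite !mxE eq_sym.
have sE : gramE8^T = gramE8.
  by apply/matrixP => i k; rewrite !mxE eq_sym; case: eqP => // _; rewrite orbC.
have sD m p (A : 'M[int]_m) (B : 'M[int]_p) :
    A^T = A -> B^T = B -> (dsum A B)^T = dsum A B.
  by move=> hA hB; rewrite /dsum tr_block_mx hA hB !trmx0.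
exact: (sD _ _ _ _ sU (sD _ _ _ _ sU (sD _ _ _ _ sU (sD _ _ _ _ sE sE)))).
Qed.

Section CupProduct.
Variable R : realType.
Local Notation C := R[i].
Local Notation H2 := 'rV[C]_22.
Implicit Types a b c : H2.

Lemma cupE a b : cup a b =
  \sum_i \sum_k toC R gramK3 k i * (a 0 k * b 0 i).
Proof.
rewrite /cup !mxE; apply: eq_bigr => i _; rewrite !mxE mulr_suml.
by apply: eq_bigr => k _; rewrite mxE; ring.
Qed.

Lemma cupC a b : cup a b = cup b a.
Proof.
rewrite !cupE exchange_big; apply: eq_bigr => i _; apply: eq_bigr => k _.
have -> : toC R gramK3 k i = toC R gramK3 i k.
  rewrite [LHS]mxE [RHS]mxE; congr (_%:~R).
  by have := congr1 (fun A : 'M[int]_22 => A i k) gramK3_sym; rewrite mxE.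
by ring.
Qed.

Lemma cupDl a b c : cup (a + b) c = cup a c + cup b c.
Proof. by rewrite /cup !mulmxDl mxE. Qed.

Lemma cupDr a b c : cup a (b + c) = cup a b + cup a c.
Proof. by rewrite cupC cupDl !(cupC a). Qed.

Lemma cupZl (x : C) a b : cup (x *: a) b = x * cup a b.
Proof. by rewrite /cup -!scalemxAl mxE. Qed.

Lemma cupZr (x : C) a b : cup a (x *: b) = x * cup a b.
Proof. by rewrite cupC cupZl cupC. Qed.

(** The shape in which the Picard-Fuchs equation is paired with a fixed vector. *)
Lemma cup_comb3 a (x y s t : C) b c d e :
  x *: b = y *: c + s *: d + t *: e ->
  x * cup a b = y * cup a c + s * cup a d + t * cup a e.
Proof. by move=> /(congr1 (cup a)); rewrite !cupDr !cupZr. Qed.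

Lemma cup0l a : cup 0 a = 0.
Proof. by rewrite /cup !mul0mx mxE. Qed.

Lemma cup0r a : cup a 0 = 0.
Proof. by rewrite cupC cup0l. Qed.

Lemma conj_toC m p (A : 'M[int]_(m, p)) : conj_mx (toC R A) = toC R A.
Proof.
by apply/matrixP => i k; rewrite !mxE; exact: (rmorph_int (@conjc R)).
Qed.

Lemma conj_mxM m p q (A : 'M[C]_(m, p)) (B : 'M[C]_(p, q)) :
  conj_mx (A *m B) = conj_mx A *m conj_mx B.
Proof. exact: map_mxM. Qed.

Lemma conj_mxK m p (A : 'M[C]_(m, p)) : conj_mx (conj_mx A) = A.
Proof. by apply/matrixP => i k; rewrite !mxE conjcK. Qed.

Lemma conj_mxZ m p (x : C) (A : 'M[C]_(m, p)) : conj_mx (x *: A) = x^*%C *: conj_mx A.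
Proof. exact: map_mxZ. Qed.

Lemma conj_mxD m p (A B : 'M[C]_(m, p)) : conj_mx (A + B) = conj_mx A + conj_mx B.
Proof. exact: map_mxD. Qed.

Lemma conj_mx_sub m p q (A : 'M[C]_(m, q)) (B : 'M[C]_(p, q)) :
  (A <= B)%MS -> (conj_mx A <= conj_mx B)%MS.
Proof. by move=> /submxP[x ->]; rewrite conj_mxM submxMl. Qed.

(** The Gram matrix is integral, hence fixed by conjugation. *)
Lemma cup_conj a b : (cup a b)^*%C = cup (conj_mx a) (conj_mx b).
Proof.
have -> : cup (conj_mx a) (conj_mx b) = conj_mx (a *m toC R gramK3 *m b^T) 0 0.
  by rewrite !conj_mxM conj_toC /conj_mx -map_trmx.
by rewrite [RHS]mxE.
Qed.

Lemma cup_orth m p (A : 'M[C]_(m, 22)) (B : 'M[C]_(p, 22)) a b :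
  A *m toC R gramK3 *m B^T = 0 -> (a <= A)%MS -> (b <= B)%MS -> cup a b = 0.
Proof.
move=> AB /submxP[x ->] /submxP[y ->]; rewrite /cup trmx_mul.
by rewrite -[_ *m A *m _]mulmxA -mulmxA [_ *m (B^T *m _)]mulmxA AB mul0mx mulmx0 mxE.
Qed.

Lemma rank1_colinear m (S : 'M[C]_(m, 22)) a b :
  \rank S = 1%N -> (a <= S)%MS -> (b <= S)%MS -> a != 0 -> exists x, b = x *: a.
Proof.
move=> rS aS bS a0; apply/sub_rVP; apply: submx_trans bS _.
by rewrite -(mxrank_leqif_sup aS) rank_rV a0 rS.
Qed.

End CupProduct.

(** * Derivatives of vector-valued functions *)

Section VectorCalculus.
Variable R : realType.
Local Notation C := R[i].
Variable D : set C.
Hypothesis oD : Defs.openC D.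
Variables m p : nat.
Implicit Types (f : C -> C) (s t : C -> 'M[C]_(m, p)).

Lemma smooth_mx_eq s t : (forall z, D z -> s z = t z) -> smooth_mx D s -> smooth_mx D t.
Proof. by move=> st hs i k; apply: (smooth_eq oD) (hs i k) => z /st ->. Qed.

Lemma du_mx_eq s t z : (forall w, D w -> s w = t w) -> D z -> smooth_mx D s ->
  du_mx s z = du_mx t z /\ dub_mx s z = dub_mx t z.
Proof.
move=> st Dz hs; split; apply/matrixP => i k; rewrite !mxE.
  by apply: (du_eq oD _ Dz (hs i k)).1 => w /st ->.
by apply: (du_eq oD _ Dz (hs i k)).2 => w /st ->.
Qed.

Lemma smooth_mxD s t : smooth_mx D s -> smooth_mx D t ->
  smooth_mx D (fun z => s z + t z).
Proof.
move=> hs ht i k; apply: (smooth_eq oD) (smoothD oD (hs i k) (ht i k)) => z _.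
by rewrite mxE.
Qed.

Lemma smooth_mxZ f s : smooth D f -> smooth_mx D s ->
  smooth_mx D (fun z => f z *: s z).
Proof.
move=> hf hs i k; apply: (smooth_eq oD) (smoothM oD hf (hs i k)) => z _.
by rewrite mxE.
Qed.

Lemma smooth_conj_mx s : smooth_mx D s -> smooth_mx D (fun z => conj_mx (s z)).
Proof.
move=> hs i k; apply: (smooth_eq oD) (smooth_conj oD (hs i k)) => z _.
by rewrite mxE.
Qed.

Lemma du_mx_add s t z : smooth_mx D s -> smooth_mx D t -> D z ->
  du_mx (fun w => s w + t w) z = du_mx s z + du_mx t z.
Proof.
move=> hs ht Dz; apply/matrixP => i k; rewrite !mxE.
rewrite -(du_add (hs i k) (ht i k) Dz).1; congr (du _ z).
by apply/funext => w; rewrite mxE.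
Qed.

Lemma du_mx_scale f s z : smooth D f -> smooth_mx D s -> D z ->
  du_mx (fun w => f w *: s w) z = du f z *: s z + f z *: du_mx s z.
Proof.
move=> hf hs Dz; apply/matrixP => i k; rewrite !mxE.
rewrite -(du_mul hf (hs i k) Dz).1; congr (du _ z).
by apply/funext => w; rewrite mxE.
Qed.

Lemma du_conj_mx s z : smooth_mx D s -> D z ->
  du_mx (fun w => conj_mx (s w)) z = conj_mx (dub_mx s z) /\
  dub_mx (fun w => conj_mx (s w)) z = conj_mx (du_mx s z).
Proof.
move=> hs Dz; split; apply/matrixP => i k; rewrite !mxE.
  rewrite -(du_conjc (hs i k) Dz).1; congr (du _ z).
  by apply/funext => w; rewrite mxE.
rewrite -(du_conjc (hs i k) Dz).2; congr (dub _ z).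
by apply/funext => w; rewrite mxE.
Qed.

Lemma holomorphic_mx_smooth s : holomorphic_mx D s -> smooth_mx D s.
Proof. by move=> hs i k; have [] := hs i k. Qed.

Lemma holomorphic_mx_dub s z : holomorphic_mx D s -> D z -> dub_mx s z = 0.
Proof. by move=> hs Dz; apply/matrixP => i k; rewrite !mxE; exact: (hs i k).2. Qed.

Lemma holomorphic_du_mx s : holomorphic_mx D s -> holomorphic_mx D (du_mx s).
Proof.
move=> hs i k; rewrite (_ : (fun z => _) = du (fun z => s z i k)).
  exact: holomorphic_du.
by apply/funext => z; rewrite mxE.
Qed.

Lemma du_sum (I : Type) (r : seq I) (F : I -> C -> C) z :
  (forall i, smooth D (F i)) -> D z ->
  du (fun w => \sum_(i <- r) F i w) z = \sum_(i <- r) du (F i) z /\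
  dub (fun w => \sum_(i <- r) F i w) z = \sum_(i <- r) dub (F i) z.
Proof.
move=> hF Dz; elim: r => [|i r [IH IHb]].
  rewrite !big_nil (_ : (fun w => _) = (fun=> 0)); first exact: du_cst.
  by apply/funext => w; rewrite big_nil.
rewrite !big_cons -IH -IHb -(du_add (hF i) (smooth_sum oD r hF) Dz).1.
rewrite -(du_add (hF i) (smooth_sum oD r hF) Dz).2.
rewrite (_ : (fun w => _) = (fun w => F i w + \sum_(k <- r) F k w)) //.
by apply/funext => w; rewrite big_cons.
Qed.

End VectorCalculus.

(** * Leibniz rule for the cup product, and flatness of constant subspaces *)

Section CupCalculus.
Variable R : realType.
Local Notation C := R[i].
Variable D : set C.
Hypothesis oD : Defs.openC D.
Implicit Types s t : C -> 'rV[C]_22.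

Lemma smooth_cup s t : smooth_mx D s -> smooth_mx D t ->
  smooth D (fun z => cup (s z) (t z)).
Proof.
move=> hs ht; apply: (smooth_eq oD) (smooth_sum oD _ (fun i => smooth_sum oD _
  (fun k => smoothM oD (smooth_cst oD (toC R gramK3 k i)) (smoothM oD (hs 0 k) (ht 0 i))))).
by move=> z _; rewrite cupE.
Qed.

Lemma du_cup s t z : smooth_mx D s -> smooth_mx D t -> D z ->
  du (fun w => cup (s w) (t w)) z = cup (du_mx s z) (t z) + cup (s z) (du_mx t z) /\
  dub (fun w => cup (s w) (t w)) z = cup (dub_mx s z) (t z) + cup (s z) (dub_mx t z).
Proof.
move=> hs ht Dz.
pose F i k := fun w => toC R gramK3 k i * (s w 0 k * t w 0 i).
have hM i k : smooth D (fun w => s w 0 k * t w 0 i) by exact: (smoothM oD).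
have hF i k : smooth D (F i k) by apply: (smoothM oD) (hM i k); exact: (smooth_cst oD).
have hS i : smooth D (fun w => \sum_k F i k w) by exact: (smooth_sum oD).
rewrite (_ : (fun w => _) = (fun w => \sum_i \sum_k F i k w)); last first.
  by apply/funext => w; rewrite cupE.
have [-> ->] := du_sum oD (index_enum 'I_22) hS Dz.
rewrite !cupE -!big_split /=; split; apply: eq_bigr => i _; rewrite -big_split /=.
  rewrite (du_sum oD _ (hF i) Dz).1; apply: eq_bigr => k _.
  rewrite (du_mul (smooth_cst oD _) (hM i k) Dz).1 (du_mul (hs 0 k) (ht 0 i) Dz).1.
  by rewrite (du_cst _ z).1 !mxE; ring.
rewrite (du_sum oD _ (hF i) Dz).2; apply: eq_bigr => k _.
rewrite (du_mul (smooth_cst oD _) (hM i k) Dz).2 (du_mul (hs 0 k) (ht 0 i) Dz).2.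
by rewrite (du_cst _ z).2 !mxE; ring.
Qed.

(** The kernel of a constant matrix is a flat subbundle. It is applied to [spanT], the kernel of
    pairing with M, which does not vary with z. *)
Lemma du_kermx q (M : 'M[C]_(22, q)) s z : smooth_mx D s ->
  (forall w, D w -> s w *m M = 0) -> D z -> du_mx s z *m M = 0.
Proof.
move=> hs s0 Dz; apply/matrixP => i l; rewrite mxE [RHS]mxE.
pose F k := fun w => M k l * s w i k.
have hF k : smooth D (F k) by apply: (smoothM oD) (hs i k); exact: (smooth_cst oD).
have e0 w : D w -> \sum_k F k w = 0.
  move=> Dw; have := congr1 (fun A : 'M[C]_(_, _) => A i l) (s0 w Dw).
  rewrite !mxE => e0; rewrite -[RHS]e0.
  by apply: eq_bigr => k _; rewrite /F mulrC.
have := (du_eq oD e0 Dz (smooth_sum oD _ hF)).1.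
rewrite (du_cst _ z).1 (du_sum oD _ hF Dz).1 => e1; rewrite -[RHS]e1; apply: eq_bigr => k _.
rewrite (du_mul (smooth_cst oD (M k l)) (hs i k) Dz).1 (du_cst _ z).1 mul0r add0r.
by rewrite mxE mulrC.
Qed.

End CupCalculus.

(** * Hodge structures of K3 type *)

Section HodgeStructure.
Variable R : realType.
Local Notation C := R[i].
Variable H : hodge_dec R.
Hypothesis hH : K3_hodge_structure H.
Implicit Types a b : 'rV[C]_22.

Lemma capmx_eq0 (A B : 'M[C]_22) : (\rank A + \rank B <= \rank (A + B)%MS)%N ->
  (A :&: B)%MS = 0.
Proof.
move=> h; apply/eqP; rewrite -mxrank_eq0 -leqn0.
by rewrite -(leq_add2l (\rank (A + B)%MS)) mxrank_sum_cap addn0.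
Qed.

(** The ranks 1, 20 and 1 add up to the rank 22 of the sum, so the sum is direct; this is what makes
    the projections inside [weil] behave as expected. *)
Lemma hodge_caps : [/\ (H20 H :&: (H11 H + H02 H))%MS = 0,
  (H11 H :&: (H20 H + H02 H))%MS = 0 & (H02 H :&: (H20 H + H11 H))%MS = 0].
Proof.
case: hH => [[r20 r11 r02 full] _ _ _ _].
have rk : \rank (H20 H + H11 H + H02 H)%MS = 22%N by rewrite full mxrank1.
split; apply: capmx_eq0.
- rewrite addsmxA rk r20 (leq_trans (leq_add (leqnn _) (mxrank_adds_leqif _ _))) //.
  by rewrite r11 r02.
- rewrite addsmxA (addsmxC (H11 H)) rk r11.
  by rewrite (leq_trans (leq_add (leqnn _) (mxrank_adds_leqif _ _))) // r20 r02.
- rewrite (addsmxC (H02 H)) rk r02.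
  by rewrite (leq_trans (leq_add (leqnn _) (mxrank_adds_leqif _ _))) // r20 r11.
Qed.

Lemma proj11_11 a : (a <= H11 H)%MS -> a *m proj11 H = a.
Proof. by case: hodge_caps => _ c _ ha; rewrite /proj11 proj_mx_id. Qed.

Lemma proj11_20 a : (a <= H20 H)%MS -> a *m proj11 H = 0.
Proof.
case: hodge_caps => _ c _ ha; rewrite /proj11 proj_mx_0 //.
exact: submx_trans ha (addsmxSl _ _).
Qed.

Lemma weil20 a : (a <= H20 H)%MS -> weil H a = - a.
Proof.
move=> ha; rewrite /weil proj11_20 // addr0.
case: hodge_caps => c20 _ c02.
rewrite /proj20 proj_mx_id // /proj02 proj_mx_0 //; last first.
  exact: submx_trans ha (addsmxSl _ _).
by rewrite scaler0 addr0 sqr_i scaleN1r.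
Qed.

Lemma weil11 a : (a <= H11 H)%MS -> weil H a = a.
Proof.
move=> ha; rewrite /weil proj11_11 //.
case: hodge_caps => c20 _ c02.
rewrite /proj20 proj_mx_0 // /proj02 ?proj_mx_0 // ?scaler0 ?add0r ?addr0 //.
  exact: submx_trans ha (addsmxSr _ _).
exact: submx_trans ha (addsmxSl _ _).
Qed.

Lemma herm20 a b : (a <= H20 H)%MS -> herm H a b = cup a (conj_mx b).
Proof. by move=> ha; rewrite /herm /polQ weil20 // -(scaleN1r a) cupZl mulN1r opprK. Qed.

Lemma herm11 a b : (a <= H11 H)%MS -> herm H a b = - cup a (conj_mx b).
Proof. by move=> ha; rewrite /herm /polQ weil11. Qed.

Lemma conj20 a : (a <= H20 H)%MS -> (conj_mx a <= H02 H)%MS.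
Proof. by case: hH => _ e _ _ _ ha; rewrite -e conj_mx_sub. Qed.

Lemma conj11 a : (a <= H11 H)%MS -> (conj_mx a <= H11 H)%MS.
Proof. by case: hH => _ _ e _ _ ha; rewrite -e conj_mx_sub. Qed.

Lemma cup20_20 a b : (a <= H20 H)%MS -> (b <= H20 H)%MS -> cup a b = 0.
Proof. by case: hH => _ _ _ [e _ _ _] _; exact: cup_orth. Qed.

Lemma cup20_11 a b : (a <= H20 H)%MS -> (b <= H11 H)%MS -> cup a b = 0.
Proof. by case: hH => _ _ _ [_ e _ _] _; exact: cup_orth. Qed.

Lemma cup02_11 a b : (a <= H02 H)%MS -> (b <= H11 H)%MS -> cup a b = 0.
Proof. by case: hH => _ _ _ [_ _ e _] _; exact: cup_orth. Qed.

Lemma cup20_pos a : (a <= H20 H)%MS -> a != 0 -> 0 < cup a (conj_mx a).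
Proof. by case: hH => _ _ _ _; exact. Qed.

Lemma H20_colinear a b : (a <= H20 H)%MS -> (b <= H20 H)%MS -> a != 0 ->
  exists x, b = x *: a.
Proof. by case: hH => [[r20 _ _ _] _ _ _ _]; exact: rank1_colinear. Qed.

Lemma H02_colinear a b : (a <= H02 H)%MS -> (b <= H02 H)%MS -> a != 0 ->
  exists x, b = x *: a.
Proof. by case: hH => [[_ _ r02 _] _ _ _ _]; exact: rank1_colinear. Qed.

Variable j : 'M[int]_(19, 22).
Hypothesis hT : transcendental_HS j H.

Lemma sub_spanT a : (a <= spanT R j)%MS = (a *m (toC R gramK3 *m (toC R j)^T) == 0).
Proof. exact: sub_kermx. Qed.

(** H^{2,0} and its intersection with T are both lines, hence equal. *)
Lemma H20_sub_T a : (a <= H20 H)%MS -> (a <= spanT R j)%MS.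
Proof.
case: hH => [[r20 _ _ _] _ _ _ _]; case: hT => [[t20 _ _] _ _] ha.
have s : (spanT R j :&: H20 H <= H20 H)%MS by exact: capmxSr.
have : (H20 H <= spanT R j :&: H20 H)%MS.
  by rewrite -(mxrank_leqif_sup s) t20 r20.
by rewrite sub_capmx => /andP[h _]; exact: submx_trans ha h.
Qed.

Lemma conj_T a : (a <= spanT R j)%MS -> (conj_mx a <= spanT R j)%MS.
Proof.
rewrite !sub_spanT => /eqP h; apply/eqP.
rewrite -(conj_toC R gramK3) -(conj_toC R j) /conj_mx map_trmx -!map_mxM h.
exact: map_mx0.
Qed.

Lemma T11_colinear a b : (a <= spanT R j)%MS -> (a <= H11 H)%MS ->
  (b <= spanT R j)%MS -> (b <= H11 H)%MS -> a != 0 -> exists x, b = x *: a.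
Proof.
case: hT => [[_ t11 _] _ _] a1 a2 b1 b2.
by apply: (rank1_colinear t11); rewrite sub_capmx ?a1 ?b1.
Qed.

Lemma T_pos11 a : (a <= spanT R j)%MS -> (a <= H11 H)%MS -> a != 0 ->
  0 < - cup a (conj_mx a).
Proof. by case: hT => _ _ pos aT a11 /(pos _ aT); rewrite herm11. Qed.

(** Each Hodge component of T is a line, here with generators a, b and conj a. It serves to locate
    [omega2] by computing three pairings. *)
Lemma T_decomp a b c : (a <= H20 H)%MS -> a != 0 ->
  (b <= spanT R j)%MS -> (b <= H11 H)%MS -> b != 0 ->
  (c <= spanT R j)%MS -> exists x y z, c = x *: a + y *: b + z *: conj_mx a.
Proof.
move=> a20 a0 bT b11 b0; case: (hT) => [[_ _ _] dec _]; rewrite dec.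
move=> /sub_addsmxP[[u v] /= ->].
have : (u *m (spanT R j :&: H20 H + spanT R j :&: H11 H)%MS
        <= spanT R j :&: H20 H + spanT R j :&: H11 H)%MS by rewrite submxMl.
move=> /sub_addsmxP[[u' v'] /= ->].
have p20 : (u' *m (spanT R j :&: H20 H)%MS <= H20 H)%MS.
  exact: submx_trans (submxMl _ _) (capmxSr _ _).
have pT : (v' *m (spanT R j :&: H11 H)%MS <= spanT R j)%MS.
  exact: submx_trans (submxMl _ _) (capmxSl _ _).
have p11 : (v' *m (spanT R j :&: H11 H)%MS <= H11 H)%MS.
  exact: submx_trans (submxMl _ _) (capmxSr _ _).
have p02 : (v *m (spanT R j :&: H02 H)%MS <= H02 H)%MS.
  exact: submx_trans (submxMl _ _) (capmxSr _ _).
have ca0 : conj_mx a != 0.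
  by apply: contra a0 => /eqP e; rewrite -(conj_mxK a) e /conj_mx map_mx0.
have [x ->] := H20_colinear a20 p20 a0.
have [y ->] := T11_colinear bT b11 pT p11 b0.
have [t ->] := H02_colinear (conj20 a20) p02 ca0.
by exists x, y, t.
Qed.

End HodgeStructure.

(** * Gauge transformations of rank 3 *)

Section Matrices3.
Variable R : realType.
Local Notation C := R[i].
Local Notation M3 a b c d e f g h i :=
  (mx3 [:: [:: a; b; c]; [:: d; e; f]; [:: g; h; i]]).

Lemma mulmx_M3 (a b c d e f g h i a' b' c' d' e' f' g' h' i' : C) :
  M3 a b c d e f g h i *m M3 a' b' c' d' e' f' g' h' i' =
  M3 (a * a' + b * d' + c * g') (a * b' + b * e' + c * h') (a * c' + b * f' + c * i')
     (d * a' + e * d' + f * g') (d * b' + e * e' + f * h') (d * c' + e * f' + f * i')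
     (g * a' + h * d' + i * g') (g * b' + h * e' + i * h') (g * c' + h * f' + i * i').
Proof.
apply/matrixP => k l; rewrite mxE !big_ord_recl big_ord0 !mxE /= addr0 addrA.
by case: k => [[|[|[|]]] ?] //; case: l => [[|[|[|]]] ?].
Qed.

Lemma add_M3 (a b c d e f g h i a' b' c' d' e' f' g' h' i' : C) :
  M3 a b c d e f g h i + M3 a' b' c' d' e' f' g' h' i' =
  M3 (a + a') (b + b') (c + c') (d + d') (e + e') (f + f') (g + g') (h + h') (i + i').
Proof.
apply/matrixP => k l; rewrite !mxE.
by case: k => [[|[|[|]]] ?] //; case: l => [[|[|[|]]] ?].
Qed.

Lemma scale_M3 (x a b c d e f g h i : C) :
  x *: M3 a b c d e f g h i =
  M3 (x * a) (x * b) (x * c) (x * d) (x * e) (x * f) (x * g) (x * h) (x * i).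
Proof.
apply/matrixP => k l; rewrite !mxE.
by case: k => [[|[|[|]]] ?] //; case: l => [[|[|[|]]] ?].
Qed.

Lemma one_M3 : 1%:M = M3 1 0 0 0 1 0 0 0 1 :> 'M[C]_3.
Proof.
apply/matrixP => k l; rewrite !mxE.
by case: k => [[|[|[|]]] ?] //; case: l => [[|[|[|]]] ?].
Qed.

Lemma du_M3 (a b c d e f g h i : C -> C) z :
  du_mx (fun w => M3 (a w) (b w) (c w) (d w) (e w) (f w) (g w) (h w) (i w)) z =
    M3 (du a z) (du b z) (du c z) (du d z) (du e z) (du f z) (du g z) (du h z) (du i z) /\
  dub_mx (fun w => M3 (a w) (b w) (c w) (d w) (e w) (f w) (g w) (h w) (i w)) z =
    M3 (dub a z) (dub b z) (dub c z) (dub d z) (dub e z) (dub f z) (dub g z) (dub h z)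
       (dub i z).
Proof.
have entry (F : C -> 'M[C]_3) (f' : C -> C) k l : (forall w, F w k l = f' w) ->
    du_mx F z k l = du f' z /\ dub_mx F z k l = dub f' z.
  by move=> /funext Ff; rewrite !mxE Ff.
split; apply/matrixP => -[[|[|[|k]]] hk] [[|[|[|l]]] hl]; try by [].
all: rewrite [RHS]mxE /=.
1-9: by apply: (entry _ _ _ _ _).1 => w; rewrite mxE.
all: by apply: (entry _ _ _ _ _).2 => w; rewrite mxE.
Qed.

Lemma smooth_M3 (D : set C) (a b c d e f g h i : C -> C) : Defs.openC D ->
  smooth D a -> smooth D b -> smooth D c -> smooth D d -> smooth D e -> smooth D f ->
  smooth D g -> smooth D h -> smooth D i ->
  smooth_mx D (fun w => M3 (a w) (b w) (c w) (d w) (e w) (f w) (g w) (h w) (i w)).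
Proof.
move=> oD ha hb hc hd he hf hg hh hi k l.
have E s : (forall w, s w =
      mx3 [:: [:: a w; b w; c w]; [:: d w; e w; f w]; [:: g w; h w; i w]] k l) ->
    smooth D s -> smooth D (fun w =>
      mx3 [:: [:: a w; b w; c w]; [:: d w; e w; f w]; [:: g w; h w; i w]] k l).
  by move=> e0 hs; apply: (smooth_eq oD) hs => w _.
case: k E => [[|[|[|]]] ?] // E; case: l E => [[|[|[|]]] ?] // E.
- by apply: E ha => w; rewrite mxE.
- by apply: E hb => w; rewrite mxE.
- by apply: E hc => w; rewrite mxE.
- by apply: E hd => w; rewrite mxE.
- by apply: E he => w; rewrite mxE.
- by apply: E hf => w; rewrite mxE.
- by apply: E hg => w; rewrite mxE.
- by apply: E hh => w; rewrite mxE.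
- by apply: E hi => w; rewrite mxE.
Qed.

(** Common shape of [Ainv] and of the gauge matrix. Matrices stay explicit lists of nine entries, so
    that identities between them split into scalar ones. *)
Definition unitri (x b y : C) : 'M[C]_3 := M3 1 x b 0 1 y 0 0 1.

Lemma mul_unitri (x b y : C) :
  unitri x b y *m unitri (- x) (x * y - b) (- y) = 1%:M.
Proof. by rewrite /unitri mulmx_M3 one_M3; congr (M3 _ _ _ _ _ _ _ _ _); ring. Qed.

Lemma unitri_unit (x b y : C) : unitri x b y \in unitmx.
Proof. by have /mulmx1_unit[] := mul_unitri x b y. Qed.

Lemma inv_unitri (x b y : C) :
  invmx (unitri (- x) (x * y - b) (- y)) = unitri x b y.
Proof.
have u := unitri_unit (- x) (x * y - b) (- y).
by rewrite -[LHS]mul1mx -(mul_unitri x b y) mulmxK.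
Qed.

(** The du part of the gauge identity, with t = hbar, k = K_u, q = p, b = B_uu, derivatives dk, dq,
    db, and c0, c1 the values of [b0], [b1]. The first summand is A^{-1} dA; the diagonal matrix is
    the Chern form with Gamma = k - q. The hypotheses are the definition of [Buu'] and the two
    coefficient comparisons. *)
Lemma gauge_u (t k q b dk dq db c0 c1 : C) : t != 0 ->
  dk = b - q * k -> db = (k - 2 * q) * b + c0 / t ^+ 3 ->
  dk + dq + b - c1 / t ^+ 2 = (k - 2 * q) * (k + q) ->
  unitri (t * k) (t ^+ 2 * b) (t * (k + q)) *m
    M3 0 (- t * dk) (t ^+ 2 * (dk * (k + q) + k * (dk + dq) - db))
       0 0 (- t * (dk + dq)) 0 0 0
  + unitri (t * k) (t ^+ 2 * b) (t * (k + q)) *m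
    (t^-1 *: higgs R + M3 (- k) 0 0 0 (k - q - k) 0 0 0 (2 * (k - q) - k)) *m
    unitri (- (t * k)) (t * k * (t * (k + q)) - t ^+ 2 * b) (- (t * (k + q)))
  = t^-1 *: M3 0 0 (- c0) 1 0 (- c1) 0 1 (- (3 * t * q)).
Proof.
move=> t0 -> edb e1.
(* Solving the hypotheses for c0 and c1 leaves an identity in free variables, which [field]
   decides. *)
have -> : c0 = t ^+ 3 * (db - (k - 2 * q) * b) by rewrite edb; field.
have -> : c1 = t ^+ 2 * (b - q * k + dq + b - (k - 2 * q) * (k + q)).
  by rewrite -e1; field.
rewrite /unitri /higgs !(scale_M3, mulmx_M3, add_M3).
by congr (M3 _ _ _ _ _ _ _ _ _); field.
Qed.

(** The d(ubar) part, with g = G. In the matrix of ubar-derivatives, the corner t^2 g (k + q)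
    already uses that B_uu has ubar-derivative k g. *)
Lemma gauge_ub (t k q b g : C) :
  unitri (t * k) (t ^+ 2 * b) (t * (k + q)) *m
    M3 0 (- t * g) (t ^+ 2 * (g * (k + q))) 0 0 (- t * g) 0 0 0
  + unitri (t * k) (t ^+ 2 * b) (t * (k + q)) *m
    (t *: M3 0 g 0 0 0 g 0 0 0) *m
    unitri (- (t * k)) (t * k * (t * (k + q)) - t ^+ 2 * b) (- (t * (k + q)))
  = 0.
Proof.
have -> : 0 = M3 0 0 0 0 0 0 0 0 0 :> 'M[C]_3.
  apply/matrixP => i l; rewrite !mxE.
  by case: i => [[|[|[|]]] ?] //; case: l => [[|[|[|]]] ?].
rewrite /unitri !(scale_M3, mulmx_M3, add_M3).
by congr (M3 _ _ _ _ _ _ _ _ _); ring.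
Qed.

End Matrices3.

(** * The Hodge bundle over the base *)

Section HodgeBundle.
Variable R : realType.
Local Notation C := R[i].
Variables (n : nat) (D : set C) (j : 'M[int]_(19, 22)) (X : C -> hodge_dec R).
Hypothesis oD : Defs.openC D.
Hypothesis hX : complete_polarized_family n D j X.
Variable w0 : C -> 'rV[C]_22.
Hypothesis hw0 : local_frame X D w0.

(* Variables rather than nested du_mx, so that derivatives of different orders
   are never compared by unfolding. *)
Variables w1 w2 w3 : C -> 'rV[C]_22.
Hypotheses (e1 : w1 = du_mx w0) (e2 : w2 = du_mx w1) (e3 : w3 = du_mx w2).

Local Notation h := (fun z => cup (w0 z) (conj_mx (w0 z))).
Local Notation K := (Ku X w0).
Local Notation G := (Guu X w0).
Local Notation om1 := (omega1 X w0).
Local Notation Y := (fun z => cup (w1 z) (w1 z)).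

Lemma frame_hol : [/\ holomorphic_mx D w0, holomorphic_mx D w1 & holomorphic_mx D w2].
Proof.
case: hw0 => h0 _; have h1 := holomorphic_du_mx oD h0.
rewrite e2 e1; exact: (And3 h0 h1 (holomorphic_du_mx oD h1)).
Qed.

Lemma frame_smooth : [/\ smooth_mx D w0, smooth_mx D w1 & smooth_mx D w2].
Proof. case: frame_hol => h0 h1 h2.
exact: (And3 (holomorphic_mx_smooth h0) (holomorphic_mx_smooth h1)
  (holomorphic_mx_smooth h2)).
Qed.

Lemma frame_smooth_conj : smooth_mx D (fun z => conj_mx (w0 z)).
Proof. by case: frame_smooth => h0 _ _; exact: (smooth_conj_mx oD h0). Qed.

Lemma frame20 z : D z -> (w0 z <= H20 (X z))%MS.
Proof. by case: hw0 => _ f /f[]. Qed.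

Lemma h_pos z : D z -> 0 < h z.
Proof.
move=> Dz; case: hw0 => _ /(_ z Dz)[h20 hn0].
exact: (cup20_pos (fam_hodge hX Dz) h20 hn0).
Qed.

Lemma h_neq0 z : D z -> h z != 0.
Proof. by move=> /h_pos; rewrite lt0r => /andP[]. Qed.

Lemma smooth_h : smooth D h.
Proof. by case: frame_smooth => h0 _ _; exact: (smooth_cup oD h0 frame_smooth_conj). Qed.

Lemma hnormE z : D z -> h z = hnorm X w0 z.
Proof. by move=> Dz; rewrite /hnorm (herm20 (fam_hodge hX Dz)) // frame20. Qed.

Lemma smooth_hnorm : smooth D (hnorm X w0).
Proof. by apply: (smooth_eq oD) smooth_h => z; exact: hnormE. Qed.

Lemma du_h z : D z -> du h z = cup (w1 z) (conj_mx (w0 z)) /\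
  dub h z = cup (w0 z) (conj_mx (w1 z)).
Proof.
move=> Dz; case: frame_smooth frame_hol => s0 s1 _ [h0 _ _].
have [-> ->] := du_cup oD s0 frame_smooth_conj Dz.
have [-> ->] := du_conj_mx s0 Dz.
by rewrite -e1 (holomorphic_mx_dub h0 Dz) /conj_mx map_mx0 cup0l cup0r addr0 add0r.
Qed.

Lemma du_dub_h z : D z -> du (dub h) z = cup (w1 z) (conj_mx (w1 z)).
Proof.
move=> Dz; case: frame_smooth frame_hol => s0 s1 _ [_ h1 _].
have e w : D w -> dub h w = cup (w0 w) (conj_mx (w1 w)) by move=> /du_h[].
rewrite (du_eq oD e Dz (smooth_dub oD smooth_h)).1.
rewrite (du_cup oD s0 (smooth_conj_mx oD s1) Dz).1 (du_conj_mx s1 Dz).1.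
by rewrite -e1 (holomorphic_mx_dub h1 Dz) /conj_mx map_mx0 cup0r addr0.
Qed.

Lemma smooth_potK : smooth D (potK X w0).
Proof.
apply: (smooth_lnRe oD) smooth_hnorm => z Dz.
by rewrite -hnormE // h_pos.
Qed.

Lemma du_potK z : D z -> K z = - du h z * (h z)^-1 /\
  dub (potK X w0) z = - dub h z * (h z)^-1.
Proof.
move=> Dz.
have p w : D w -> 0 < hnorm X w0 w by move=> Dw; rewrite -hnormE // h_pos.
have [g1 g2] := du_lnRe oD p smooth_hnorm Dz.
have [d1 d2] := du_eq oD hnormE Dz smooth_h.
by rewrite d1 d2 hnormE // -g1 -g2.
Qed.

Lemma smooth_Ku : smooth D K.
Proof. exact: (smooth_du oD smooth_potK). Qed.

Lemma smooth_Guu : smooth D G.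
Proof. exact: (smooth_du oD (smooth_dub oD smooth_potK)). Qed.

Lemma dub_Ku z : D z -> dub K z = G z.
Proof. by move=> Dz; rewrite /G (du_dub_comm oD smooth_potK Dz). Qed.

(** Quotient rule for K_ubar = -h_ubar / h, where the factor h_u / h that appears is -K_u. *)
Lemma GuuE z : D z -> G z * h z = - cup (w1 z) (conj_mx (w1 z)) - K z * dub h z.
Proof.
move=> Dz.
have e w : D w -> dub (potK X w0) w = - dub h w * (h w)^-1 by move=> /du_potK[].
have sdh := smooth_dub oD smooth_h.
have hV := smoothV oD h_neq0 smooth_h.
rewrite /Guu (du_eq oD e Dz (smooth_dub oD smooth_potK)).1.
rewrite (du_mul (smoothN oD sdh) hV Dz).1 (du_inv (h_neq0 Dz) smooth_h Dz).1.
have -> : du (fun w => - dub h w) z = - du (dub h) z.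
  rewrite (_ : (fun w => _) = (fun w => -1 * dub h w)); last first.
    by apply/funext => w; rewrite mulN1r.
  by rewrite (du_mul (smooth_cst oD (-1)) sdh Dz).1 (du_cst _ z).1 mul0r add0r mulN1r.
rewrite du_dub_h // (du_potK Dz).1.
by have := h_neq0 Dz; move: (h z) (du h z) (dub h z) (cup _ _) => a b c d a0; field.
Qed.

Lemma omega1E z : D z -> om1 z = w1 z + K z *: w0 z.
Proof.
move=> Dz; rewrite /omega1 /nabla -e1 /chernD (du_potK Dz).1 -hnormE //.
rewrite -(du_eq oD hnormE Dz smooth_h).1; congr (_ + _).
by rewrite mulrC mulNr scaleNr.
Qed.

Lemma smooth_omega1 : smooth_mx D om1.
Proof.
case: frame_smooth => s0 s1 _.
apply: (smooth_mx_eq oD) (smooth_mxD oD s1 (smooth_mxZ oD smooth_Ku s0)) => z Dz.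
by rewrite omega1E.
Qed.

Lemma omega1_perp z : D z -> cup (om1 z) (conj_mx (w0 z)) = 0.
Proof.
move=> Dz; rewrite omega1E // cupDl cupZl (du_potK Dz).1 (du_h Dz).1.
by rewrite divfK ?subrr // h_neq0.
Qed.

(** Griffiths transversality places om1 in H^{2,0} + H^{1,1}. Pairing with conj w kills the (1,1)
    part and is nonzero on H^{2,0}, so orthogonality to conj w removes the (2,0) part. *)
Lemma omega1_11 z : D z -> (om1 z <= H11 (X z))%MS.
Proof.
move=> Dz; have hH := fam_hodge hX Dz; case: hw0 => h0 f.
have t : (w1 z <= H20 (X z) + H11 (X z))%MS.
  by rewrite e1; apply: (fam_transversal hX oD _ h0 _ Dz) => // y /f[].
have : (om1 z <= H20 (X z) + H11 (X z))%MS.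
  rewrite omega1E // addmx_sub // scalemx_sub //.
  exact: (submx_trans (frame20 Dz) (addsmxSl _ _)).
case/sub_addsmxP=> [[u v] /= e].
have p20 : (u *m H20 (X z) <= H20 (X z))%MS by exact: submxMl.
have p11 : (v *m H11 (X z) <= H11 (X z))%MS by exact: submxMl.
have [x ex] := H20_colinear hH (frame20 Dz) p20 (f z Dz).2.
have := omega1_perp Dz; rewrite e ex cupDl cupZl.
rewrite [cup (v *m _) _]cupC (cup02_11 hH (conj20 hH (frame20 Dz)) p11) addr0.
move/eqP; rewrite mulf_eq0 (negPf (h_neq0 Dz)) orbF => /eqP ->.
by rewrite scale0r add0r.
Qed.

(** The vector w lies in T because H^{2,0} does, and T is flat, so derivatives of w stay in it. *)
Lemma frame_T z : D z -> [/\ (w0 z <= spanT R j)%MS, (w1 z <= spanT R j)%MS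
  & (w2 z <= spanT R j)%MS].
Proof.
case: frame_smooth => s0 s1 _.
have t0 y : D y -> w0 y *m (toC R gramK3 *m (toC R j)^T) = 0.
  move=> Dy; apply/eqP; rewrite -sub_spanT.
  exact: (H20_sub_T (fam_hodge hX Dy) (fam_transcendental hX Dy) (frame20 Dy)).
have t1 y : D y -> w1 y *m (toC R gramK3 *m (toC R j)^T) = 0.
  by move=> Dy; rewrite e1; exact: (du_kermx oD s0 t0 Dy).
by move=> Dz; rewrite !sub_spanT t0 // t1 // e2 (du_kermx oD s1 t1 Dz).
Qed.

Lemma omega1_T z : D z -> (om1 z <= spanT R j)%MS.
Proof.
by move=> Dz; case: (frame_T Dz) => t0 t1 _; rewrite omega1E // addmx_sub ?scalemx_sub.
Qed.

(** If om1 vanished, w' = -K_u w would have no (1,1) part and the tangent vector d/du would map to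
    0, against injectivity of the Kodaira-Spencer map, applied here with c = 1. *)
Lemma omega1_neq0 z : D z -> om1 z != 0.
Proof.
move=> Dz; have hH := fam_hodge hX Dz.
apply/eqP => e; have [inj _] := fam_complete hX oD (@subset_refl _ D) hw0 Dz.
suff /inj/eqP : (1 *: (nabla w0 z *m proj11 (X z)) <= spanM R j)%MS by rewrite oner_eq0.
have -> : nabla w0 z = om1 z - K z *: w0 z by rewrite omega1E // addrK /nabla e1.
by rewrite e sub0r mulNmx -scalemxAl (proj11_20 hH (frame20 Dz)) !scaler0 oppr0 scaler0 sub0mx.
Qed.

Lemma hnorm1E z : D z -> hnorm X om1 z = h z * G z /\ 0 < hnorm X om1 z.
Proof.
move=> Dz; have hH := fam_hodge hX Dz.
have e11 := omega1_11 Dz.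
split; last first.
  rewrite /hnorm (herm11 hH) //.
  exact: (T_pos11 hH (fam_transcendental hX Dz) (omega1_T Dz) e11 (omega1_neq0 Dz)).
rewrite /hnorm (herm11 hH) // mulrC GuuE // {1}omega1E // cupDl cupZl.
rewrite (cup20_11 hH (frame20 Dz) (conj11 hH e11)) mulr0 addr0.
rewrite omega1E // conj_mxD conj_mxZ cupDr cupZr.
(* As h is real, h_ubar is the conjugate of h_u, and both sides are -|h_u|^2 / h. *)
have -> : (K z)^*%C * cup (w1 z) (conj_mx (w0 z)) = K z * dub h z.
  have hr : (h z)^*%C = h z by rewrite cup_conj conj_mxK cupC.
  rewrite (du_potK Dz).1 (du_h Dz).1 (du_h Dz).2 -mulN1r !conjcM conjc_inv hr.
  rewrite cup_conj conj_mxK (_ : (-1)^*%C = -1); last exact: rmorphN1.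
  by rewrite (cupC (conj_mx (w1 z))); ring.
by rewrite opprD.
Qed.

Lemma cup_w0_w0 z : D z -> cup (w0 z) (w0 z) = 0.
Proof. by move=> Dz; exact: (cup20_20 (fam_hodge hX Dz) (frame20 Dz) (frame20 Dz)). Qed.

Lemma cup_w0_om1 z : D z -> cup (w0 z) (om1 z) = 0.
Proof. by move=> Dz; exact: (cup20_11 (fam_hodge hX Dz) (frame20 Dz) (omega1_11 Dz)). Qed.

Lemma cup_w0_w1 z : D z -> cup (w0 z) (w1 z) = 0.
Proof.
by move=> Dz; have := cup_w0_om1 Dz; rewrite omega1E // cupDr cupZr cup_w0_w0 // mulr0 addr0.
Qed.

Lemma smooth_Y : smooth D Y.
Proof. by case: frame_smooth => _ s1 _; exact: (smooth_cup oD s1 s1). Qed.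

Lemma cup_w0_w2 z : D z -> cup (w0 z) (w2 z) = - Y z.
Proof.
move=> Dz; case: frame_smooth => s0 s1 _.
have := (du_eq oD cup_w0_w1 Dz (smooth_cup oD s0 s1)).1.
rewrite (du_cst _ z).1 (du_cup oD s0 s1 Dz).1 -e1 -e2 => /eqP.
by rewrite addrC addr_eq0 => /eqP.
Qed.

(** Adding a multiple of w to w' does not change the square, since w is orthogonal to both w' and
    om1. *)
Lemma cup_om1_om1 z : D z -> cup (om1 z) (om1 z) = Y z.
Proof.
move=> Dz; rewrite {1}omega1E // cupDl cupZl cup_w0_om1 // mulr0 addr0.
by rewrite omega1E // cupDr cupZr (cupC (w1 z) (w0 z)) cup_w0_w1 // mulr0 addr0.
Qed.

(* conj om1 = c om1 because H^{1,1} meets T in a real line; both sides are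
   c^2 Y^2. *)
Lemma Y_conj z : D z -> Y z * (Y z)^*%C = (h z * G z) ^+ 2.
Proof.
move=> Dz; have hH := fam_hodge hX Dz.
have [t11 h11] := (omega1_T Dz, omega1_11 Dz).
have [c ec] := T11_colinear (fam_transcendental hX Dz) t11 h11
  (conj_T t11) (conj11 hH h11) (omega1_neq0 Dz).
rewrite -(hnorm1E Dz).1 /hnorm (herm11 hH) // -cup_om1_om1 // cup_conj ec.
by rewrite !cupZl !cupZr; ring.
Qed.

Lemma hG_neq0 z : D z -> h z * G z != 0.
Proof. by move=> /hnorm1E[<-]; rewrite lt0r => /andP[]. Qed.

Lemma Guu_neq0 z : D z -> G z != 0.
Proof. by move=> /hG_neq0; rewrite mulf_eq0 negb_or => /andP[]. Qed.

Lemma Y_neq0 z : D z -> Y z != 0.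
Proof.
move=> Dz; apply: contra_neq (hG_neq0 Dz) => e.
by apply/eqP; rewrite -sqrf_eq0 -Y_conj // e mul0r.
Qed.

Lemma du_Y z : D z -> du Y z = 2 * cup (w1 z) (w2 z) /\ dub Y z = 0.
Proof.
move=> Dz; case: frame_smooth frame_hol => _ s1 _ [_ h1 _].
have [-> ->] := du_cup oD s1 s1 Dz.
rewrite -e2 (holomorphic_mx_dub h1 Dz) cup0l cup0r addr0 (cupC (w2 z)).
by split=> //; ring.
Qed.

(** Differentiating (w, w'') = -Y gives (w', w'') + (w, w''') = -Y', and (w', w'') is already Y' /
    2. *)
Lemma cup_w0_w3 z : D z -> cup (w0 z) (w3 z) = - (3 / 2) * du Y z.
Proof.
move=> Dz; case: frame_smooth => s0 _ s2.
have := etrans (esym (du_cup oD s0 s2 Dz).1) (du_eq oD cup_w0_w2 Dz (smooth_cup oD s0 s2)).1.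
have -> : du (fun w => - Y w) z = - du Y z.
  rewrite (_ : (fun w => _) = (fun w => -1 * Y w)); last first.
    by apply/funext => w; rewrite mulN1r.
  by rewrite (du_mul (smooth_cst oD (-1)) smooth_Y Dz).1 (du_cst _ z).1 mul0r add0r mulN1r.
have [-> _] := du_Y Dz; rewrite -e1 -e3.
move: (cup (w1 z) (w2 z)) (cup _ (w3 z)) => a b e.
have -> : b = (a + b) - a by ring.
by rewrite e; field.
Qed.

(** * Consequences of the Picard-Fuchs equation *)

Variables (hbar : C) (b0 b1 b2 : C -> C).
Hypothesis hhbar : hbar != 0.
Hypothesis hb2 : holomorphic D b2.
Hypothesis hPF : picard_fuchs D hbar b0 b1 b2 w0.

Local Notation p := (fun z => b2 z / (3 * hbar)).

Lemma picard_fuchsE z : D z -> hbar ^+ 3 *: w3 z =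
  - (b2 z * hbar ^+ 2) *: w2 z + - (b1 z * hbar) *: w1 z + - b0 z *: w0 z.
Proof.
by move=> Dz; have := hPF Dz; rewrite /nabla -e1 -e2 -e3
  [- (b1 z * _) *: _]scaleNr [- b0 z *: _]scaleNr.
Qed.

(** Since w is orthogonal to w and w', the terms in [b0] and [b1] drop out, leaving -(3/2) hbar^3 Y'
    = b2 hbar^2 Y. *)
Lemma du_Y_PF z : D z -> du Y z = - 2 * p z * Y z.
Proof.
move=> Dz; have := cup_comb3 (w0 z) (picard_fuchsE Dz).
rewrite cup_w0_w0 // cup_w0_w1 // cup_w0_w2 // cup_w0_w3 // !mulr0 !addr0.
move: (du Y z) (Y z) (b2 z) => a b c e.
have : a * (hbar ^+ 2 * (- 3 / 2) * hbar) = c * b * hbar ^+ 2.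
  by transitivity (hbar ^+ 3 * (- (3 / 2) * a)); [field|rewrite e; ring].
move=> e5; apply: (@mulIf _ (hbar ^+ 2 * (- 3 / 2) * hbar)).
  by rewrite !mulf_neq0 ?expf_neq0 ?oppr_eq0 ?invr_eq0 ?pnatr_eq0.
by rewrite e5; field.
Qed.

(* Differentiate Y conj Y = (h G)^2, where conj Y is antiholomorphic. *)
Lemma du_hG z : D z -> du (fun w => h w * G w) z = - p z * (h z * G z).
Proof.
move=> Dz; have sm : smooth D (fun w => h w * G w) := smoothM oD smooth_h smooth_Guu.
have eY w : D w -> Y w * (Y w)^*%C = (h w * G w) * (h w * G w).
  by move=> Dw; rewrite Y_conj.
have sYc := smooth_conj oD smooth_Y.
have := (du_eq oD eY Dz (smoothM oD smooth_Y sYc)).1.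
rewrite (du_mul smooth_Y sYc Dz).1 (du_conjc smooth_Y Dz).1 (du_mul sm sm Dz).1.
rewrite (du_Y Dz).2 du_Y_PF // (_ : 0^*%C = 0); last exact: rmorph0.
have := hG_neq0 Dz; have := eY z Dz.
move: (Y z) ((Y z)^*%C) (h z * G z) (du _ z) (p z) => y yc a d q ey a0 e.
apply: (@mulIf _ (2 * a)); first by rewrite mulf_neq0 ?pnatr_eq0.
transitivity (d * a + a * d); first by ring.
rewrite -e; transitivity (- 2 * q * (y * yc)); first by ring.
by rewrite ey; ring.
Qed.

Lemma GammaE z : D z -> Gammau X w0 z = K z - p z.
Proof.
move=> Dz; have := du_hG Dz; rewrite (du_mul smooth_h smooth_Guu Dz).1 /Gammau.
rewrite (du_potK Dz).1.
have := Guu_neq0 Dz; have := h_neq0 Dz.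
move: (h z) (G z) (du h z) (du G z) (p z) => a g a' g' q a0 g0 e.
apply: (@mulIf _ (a * g)); first by rewrite mulf_neq0.
transitivity (a * g'); first by field.
have -> : a * g' = (a' * g + a * g') - a' * g by ring.
by rewrite e; field.
Qed.

Lemma smooth_p : smooth D p.
Proof. by case: hb2 => s _; exact: (smoothM oD s (smooth_cst oD _)). Qed.

Lemma du_p z : D z -> du p z = du b2 z / (3 * hbar).
Proof.
move=> Dz; case: hb2 => s _.
by rewrite (du_mul s (smooth_cst oD _) Dz).1 (du_cst _ z).1 mulr0 addr0.
Qed.

Local Notation B := (Buu' X hbar b2 w0).

Lemma Buu'E z : B z = du K z + p z * K z.
Proof. by rewrite /Buu'; congr (_ + _); rewrite mulrAC. Qed.

Lemma smooth_Buu' : smooth D B.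
Proof.
apply: (smooth_eq oD)
  (smoothD oD (smooth_du oD smooth_Ku) (smoothM oD smooth_p smooth_Ku)) => z Dz.
by rewrite Buu'E.
Qed.

Lemma du_omega1E z : D z -> du_mx om1 z = w2 z + K z *: w1 z + du K z *: w0 z.
Proof.
move=> Dz; case: frame_smooth => s0 s1 _.
rewrite (du_mx_eq oD omega1E Dz smooth_omega1).1.
rewrite (du_mx_add s1 (smooth_mxZ oD smooth_Ku s0) Dz) (du_mx_scale smooth_Ku s0 Dz).
by rewrite -e1 -e2 [_ *: w0 z + _]addrC addrA.
Qed.

(** The norm of om1 is h G, whose logarithmic u-derivative is -p; hence D_u om1 = -p om1. *)
Lemma omega2_om1 z : D z -> omega2 X w0 z = du_mx om1 z + p z *: om1 z.
Proof.
move=> Dz; rewrite /omega2 /nabla /chernD; congr (_ + _).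
have e w : D w -> h w * G w = hnorm X om1 w by move=> /hnorm1E[].
rewrite -(du_eq oD e Dz (smoothM oD smooth_h smooth_Guu)).1 -e // du_hG //.
by rewrite mulNr mulrN scaleNr opprK mulrC mulfK // hG_neq0.
Qed.

(** Origin of B_uu: the coefficient of w collects K_u' from differentiating om1 and p K_u from the
    Chern term. *)
Lemma omega2E z : D z -> omega2 X w0 z = w2 z + (K z + p z) *: w1 z + B z *: w0 z.
Proof.
move=> Dz; rewrite omega2_om1 // du_omega1E // omega1E // Buu'E scalerDr scalerA !scalerDl.
by rewrite !addrA; congr (_ + _); rewrite -!addrA; congr (_ + (_ + _)); rewrite addrC.
Qed.

Lemma omega2_02 z : D z -> omega2 X w0 z = - (Y z / h z) *: conj_mx (w0 z).
Proof.
move=> Dz; have hH := fam_hodge hX Dz; case: (frame_T Dz) => t0 t1 t2.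
case: frame_smooth => s0 _ _; have w20 := frame20 Dz; have h11 := omega1_11 Dz.
have tT : (omega2 X w0 z <= spanT R j)%MS.
  by rewrite omega2E // !addmx_sub // scalemx_sub.
have [x [y [t e]]] := T_decomp hH (fam_transcendental hX Dz) w20 (hw0.2 z Dz).2
  (omega1_T Dz) h11 (omega1_neq0 Dz) tT.
have cup_c_om1 : cup (conj_mx (w0 z)) (om1 z) = 0.
  exact: (cup02_11 hH (conj20 hH w20) h11).
have cup_cc : cup (conj_mx (w0 z)) (conj_mx (w0 z)) = 0.
  by rewrite -cup_conj cup_w0_w0 // conjc0.
(* Differentiate (om1, conj w) = 0 in u; conj w is antiholomorphic and contributes nothing. *)
have x0 : x = 0.
  have : cup (omega2 X w0 z) (conj_mx (w0 z)) = 0.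
    rewrite omega2_om1 // cupDl cupZl omega1_perp // mulr0 addr0.
    have := (du_eq oD omega1_perp Dz (smooth_cup oD smooth_omega1 frame_smooth_conj)).1.
    rewrite (du_cst _ z).1 (du_cup oD smooth_omega1 frame_smooth_conj Dz).1.
    rewrite (du_conj_mx s0 Dz).1; case: frame_hol => h0 _ _.
    by rewrite (holomorphic_mx_dub h0 Dz) /conj_mx map_mx0 cup0r addr0.
  rewrite e !cupDl !cupZl [cup (om1 z) _]cupC cup_c_om1 cup_cc !mulr0 !addr0 => /eqP.
  by rewrite mulf_eq0 (negPf (h_neq0 Dz)) orbF => /eqP.
(* Differentiating (om1, om1) = Y gives (om1', om1) = Y' / 2 = -p Y, which the term p om1 of om2
   cancels. *)
have y0 : y = 0.
  have : cup (omega2 X w0 z) (om1 z) = 0.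
    rewrite omega2_om1 // cupDl cupZl cup_om1_om1 //.
    have := (du_eq oD cup_om1_om1 Dz (smooth_cup oD smooth_omega1 smooth_omega1)).1.
    rewrite (du_cup oD smooth_omega1 smooth_omega1 Dz).1 du_Y_PF //.
    rewrite (cupC (om1 z)) => e4; apply: (@mulIf _ 2); first by rewrite pnatr_eq0.
    move: e4; move: (cup _ _) => a e4.
    have -> : (a + p z * Y z) * 2 = (a + a) + 2 * p z * Y z by ring.
    by rewrite e4; ring.
  rewrite e !cupDl !cupZl cup_c_om1 cup_w0_om1 // cup_om1_om1 // !mulr0 addr0 add0r => /eqP.
  by rewrite mulf_eq0 (negPf (Y_neq0 Dz)) orbF => /eqP.
(* Only the w'' term of om2 pairs nontrivially with w; this fixes the remaining coefficient. *)
have : cup (omega2 X w0 z) (w0 z) = - Y z.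
  rewrite omega2E // !cupDl !cupZl !(cupC _ (w0 z)) cup_w0_w2 // cup_w0_w1 //.
  by rewrite cup_w0_w0 // !mulr0 !addr0.
rewrite e x0 y0 !scale0r !add0r cupZl cupC => et.
by rewrite -mulNr -et mulfK // h_neq0.
Qed.

(** The u-derivative of conj w vanishes, so only the scalar -Y / h is differentiated, with
    logarithmic derivative Y'/Y - h_u/h = -2 p + K_u. *)
Lemma du_omega2 z : D z -> du_mx (omega2 X w0) z = (K z - 2 * p z) *: omega2 X w0 z.
Proof.
move=> Dz; case: frame_hol => hol0 _ _; have [s0 _ _] := frame_smooth.
have hV := smoothV oD h_neq0 smooth_h.
pose q z := - (Y z / h z).
have sYh : smooth D (fun z => Y z / h z) := smoothM oD smooth_Y hV.
have sq : smooth D q := smoothN oD sYh.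
have dq : du q z = (K z - 2 * p z) * q z.
  rewrite /q (_ : (fun w => _) = (fun w => -1 * (Y w / h w))); last first.
    by apply/funext => w; rewrite mulN1r.
  rewrite (du_mul (smooth_cst oD (-1)) sYh Dz).1 (du_cst _ z).1 mul0r add0r.
  rewrite (du_mul smooth_Y hV Dz).1 (du_inv (h_neq0 Dz) smooth_h Dz).1.
  rewrite du_Y_PF // (du_potK Dz).1.
  have := h_neq0 Dz; move: (h z) (Y z) (du h z) (p z) => a y a' r a0.
  by field.
have e w : D w -> q w *: conj_mx (w0 w) = omega2 X w0 w.
  by move=> Dw; rewrite omega2_02.
rewrite -(du_mx_eq oD e Dz (smooth_mxZ oD sq frame_smooth_conj)).1 -e //.
rewrite (du_mx_scale sq frame_smooth_conj Dz) (du_conj_mx s0 Dz).1.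
rewrite (holomorphic_mx_dub hol0 Dz) /conj_mx map_mx0 scaler0 addr0.
by rewrite scalerA dq.
Qed.

(** Pairing a relation with w isolates the coefficient of w''; pairing what remains with w' isolates
    that of w'. Both reduce to Y being nonzero. *)
Lemma frame_free z (x y t : C) : D z ->
  x *: w0 z + y *: w1 z + t *: w2 z = 0 -> [/\ x = 0, y = 0 & t = 0].
Proof.
move=> Dz e; have Yn := Y_neq0 Dz.
have t0 : t = 0.
  have := congr1 (cup (w0 z)) e; rewrite !cupDr !cupZr cup0r.
  rewrite cup_w0_w0 // cup_w0_w1 // cup_w0_w2 // !mulr0 !add0r => /eqP.
  by rewrite mulf_eq0 oppr_eq0 (negPf Yn) orbF => /eqP.
have y0 : y = 0.
  move: e; rewrite t0 scale0r addr0 => /(congr1 (cup (w1 z))).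
  rewrite cupDr !cupZr cup0r [cup (w1 z) (w0 z)]cupC cup_w0_w1 // mulr0 add0r => /eqP.
  by rewrite mulf_eq0 (negPf Yn) orbF => /eqP.
split=> //; move: e; rewrite t0 y0 !scale0r !addr0 => /eqP.
by rewrite scaler_eq0 (negPf (hw0.2 z Dz).2) orbF => /eqP.
Qed.

Lemma picard_fuchs_coefs z : D z ->
  du B z = (K z - 2 * p z) * B z + b0 z / hbar ^+ 3 /\
  du K z + du p z + B z - b1 z / hbar ^+ 2 = (K z - 2 * p z) * (K z + p z).
Proof.
move=> Dz; case: frame_smooth => s0 s1 s2.
have sKp : smooth D (fun w => K w + p w) := smoothD oD smooth_Ku smooth_p.
have s01 := smooth_mxD oD s2 (smooth_mxZ oD sKp s1).
have := (du_mx_eq oD omega2E Dz _).1.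
have sm : smooth_mx D (omega2 X w0).
  apply: (smooth_mx_eq oD) (smooth_mxD oD s01 (smooth_mxZ oD smooth_Buu' s0)) => w Dw.
  by rewrite omega2E.
move=> /(_ sm); rewrite du_omega2 //.
rewrite (du_mx_add s01 (smooth_mxZ oD smooth_Buu' s0) Dz).
rewrite (du_mx_add s2 (smooth_mxZ oD sKp s1) Dz).
rewrite (du_mx_scale sKp s1 Dz) (du_mx_scale smooth_Buu' s0 Dz).
rewrite (du_add smooth_Ku smooth_p Dz).1 -e1 -e2 -e3 omega2E //.
have w3E : w3 z = - (3 * p z) *: w2 z + - (b1 z / hbar ^+ 2) *: w1 z
    + - (b0 z / hbar ^+ 3) *: w0 z.
  apply: (@scalerI _ _ (hbar ^+ 3)); first by rewrite expf_neq0.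
  have c2 : hbar ^+ 3 * - (3 * p z) = - (b2 z * hbar ^+ 2) by field.
  have c1 : hbar ^+ 3 * - (b1 z / hbar ^+ 2) = - (b1 z * hbar) by field.
  have c0 : hbar ^+ 3 * - (b0 z / hbar ^+ 3) = - b0 z by field.
  by rewrite picard_fuchsE // !scalerDr !scalerA c2 c1 c0.
rewrite w3E.
move: (w0 z) (w1 z) (w2 z) (@frame_free z) => u0 u1 u2 free e.
(* The third coefficient is 0 outright: the w'' terms already agree, as (K_u + p) - 3 p = K_u - 2
   p. *)
have [|x0 y0 _] := free (du B z - (K z - 2 * p z) * B z - b0 z / hbar ^+ 3)
  (du K z + du p z + B z - b1 z / hbar ^+ 2 - (K z - 2 * p z) * (K z + p z)) 0 Dz.
  apply/rowP => i; move/rowP/(_ i): e; rewrite !mxE => e.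
  move: e; set lhs := (X in X = _ -> _); set rhs := (X in _ = X -> _) => e.
  transitivity (rhs - lhs); last by rewrite e subrr.
  by rewrite /lhs /rhs; ring.
split; last by apply/eqP; rewrite -subr_eq0 y0.
by apply/eqP; rewrite -subr_eq0 opprD addrA x0.
Qed.

(** Substituting K_u' = B - p K_u into the w' comparison gives 2 B = K_u^2 - 2 p^2 - p' + b1 /
    hbar^2; the constants 9 and 6 come from p = b2 / (3 hbar). *)
Lemma Buu_eq z : D z -> Buu X hbar b1 b2 w0 z = B z.
Proof.
move=> Dz; have [_ e] := picard_fuchs_coefs Dz.
have := Buu'E z; rewrite du_p // in e *; rewrite /Buu => eB.
move: e; have -> : du K z = B z - p z * K z by rewrite eB addrK.
move: (B z) (K z) (b2 z) (b1 z) (du b2 z) => b k c d c' e.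
apply: (@mulIf _ 2); first by rewrite pnatr_eq0.
have -> : b * 2 = (b - c / (3 * hbar) * k + c' / (3 * hbar) + b - d / hbar ^+ 2)
  + (c / (3 * hbar) * k - c' / (3 * hbar) + d / hbar ^+ 2) by ring.
by rewrite e; field.
Qed.

(** * The gauge matrix and its action on the connections *)

Local Notation E z := (unitri (- (hbar * K z))
  (hbar * K z * (hbar * (K z + p z)) - hbar ^+ 2 * B z) (- (hbar * (K z + p z)))).
Local Notation M3 a b c d e f g h i :=
  (mx3 [:: [:: a; b; c]; [:: d; e; f]; [:: g; h; i]]).

Lemma b2_eq z : b2 z = 3 * hbar * p z.
Proof. by rewrite mulrC divfK // mulf_neq0 ?pnatr_eq0. Qed.

Lemma Ainv_unitri z : D z -> Ainv X hbar b1 b2 w0 z =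
  unitri (hbar * K z) (hbar ^+ 2 * B z) (hbar * (K z + p z)).
Proof.
move=> Dz; rewrite /Ainv Buu_eq // (_ : hbar * K z + b2 z / 3 = hbar * (K z + p z)) //.
by field.
Qed.

Lemma frameNAH_comb (x y t : C) z : D z ->
  x *: w0 z + y *: (hbar *: om1 z) + t *: (hbar ^+ 2 *: omega2 X w0 z) =
  (x + y * hbar * K z + t * hbar ^+ 2 * B z) *: w0 z
  + (y * hbar + t * hbar ^+ 2 * (K z + p z)) *: w1 z + (t * hbar ^+ 2) *: w2 z.
Proof.
move=> Dz; rewrite omega2E // omega1E //.
move: (w0 z) (w1 z) (w2 z) (K z) (B z) (p z) => u0 u1 u2 k b q.
by apply/rowP => i; rewrite !mxE; ring.
Qed.

(** Uniqueness: each column of P - E gives a linear relation among the vectors of [frameNAH].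
    Rewritten in w, w', w'' it is triangular with diagonal 1, hbar, hbar^2, so independence forces
    the column to vanish from the bottom up. *)
Lemma frame_changeP z P : D z ->
  frame_change (frameNAH X hbar w0 z) (frameGM hbar w0 z) P <-> P = E z.
Proof.
move=> Dz.
have sumE (Q : 'M[C]_3) b : \sum_(a < 3) Q a b *: (frameNAH X hbar w0 z)`_a =
    Q 0 b *: w0 z + Q 1 b *: (hbar *: om1 z) + Q 2 b *: (hbar ^+ 2 *: omega2 X w0 z).
  rewrite !big_ord_recl big_ord0 /= addr0 addrA.
  by congr (Q _ b *: _ + Q _ b *: _ + Q _ b *: _); apply/val_inj.
have hE : frame_change (frameNAH X hbar w0 z) (frameGM hbar w0 z) (E z).
  move=> b; rewrite sumE frameNAH_comb // /frameGM /nabla -e1 -e2.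
  move: (w0 z) (w1 z) (w2 z) (K z) (B z) (p z) => u0 u1 u2 k c q.
  case: b => [[|[|[|]]] ?] //; apply/rowP => i; rewrite !mxE /=; ring.
split=> [hP|-> //]; apply/matrixP => a b.
have := etrans (esym (hP b)) (hE b); rewrite !sumE => /eqP.
rewrite -subr_eq0 => /eqP e.
have := @frame_free z
  ((P 0 b - E z 0 b) + (P 1 b - E z 1 b) * hbar * K z
    + (P 2 b - E z 2 b) * hbar ^+ 2 * B z)
  ((P 1 b - E z 1 b) * hbar + (P 2 b - E z 2 b) * hbar ^+ 2 * (K z + p z))
  ((P 2 b - E z 2 b) * hbar ^+ 2) Dz.
rewrite -frameNAH_comb // => -[].
  rewrite -[RHS]e.
  move: (hbar *: om1 z) (hbar ^+ 2 *: omega2 X w0 z) => v1 v2.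
  by rewrite !scalerBl; apply/rowP => i; rewrite !mxE; ring.
move=> f0 f1 /eqP; rewrite mulf_eq0 expf_eq0 /= (negPf hhbar) orbF => /eqP d2.
move: f0 f1; rewrite d2 !mul0r !addr0 => f0 /eqP.
rewrite mulf_eq0 (negPf hhbar) orbF => /eqP d1.
move: f0; rewrite d1 !mul0r addr0 => d0.
apply/eqP; rewrite -subr_eq0; apply/eqP.
case: a => [[|[|[|]]] ha] //.
- by rewrite -[RHS]d0; congr (P _ b - E z _ b); apply/val_inj.
- by rewrite -[RHS]d1; congr (P _ b - E z _ b); apply/val_inj.
- by rewrite -[RHS]d2; congr (P _ b - E z _ b); apply/val_inj.
Qed.

Lemma smooth_gauge : smooth_mx D (fun z => E z).
Proof.
have sK := smooth_Ku; have sp := smooth_p; have sB := smooth_Buu'.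
have cst c : smooth D (fun=> c) := smooth_cst oD c.
have sKp := smoothD oD sK sp.
apply: (smooth_M3 oD) (cst 1) _ _ (cst 0) (cst 1) _ (cst 0) (cst 0) (cst 1).
- exact: (smoothN oD (smoothM oD (cst hbar) sK)).
- apply: (smoothD oD); last exact: (smoothN oD (smoothM oD (cst _) sB)).
  exact: (smoothM oD (smoothM oD (cst hbar) sK) (smoothM oD (cst hbar) sKp)).
- exact: (smoothN oD (smoothM oD (cst hbar) sKp)).
Qed.

Lemma du_gauge_entries z : D z ->
  let e01 := fun w => - (hbar * K w) in
  let e12 := fun w => - (hbar * (K w + p w)) in
  let e02 := fun w => hbar * K w * (hbar * (K w + p w)) - hbar ^+ 2 * B w in
  [/\ du e01 z = - hbar * du K z, du e12 z = - hbar * (du K z + du p z) &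
      du e02 z = hbar ^+ 2 * (du K z * (K z + p z) + K z * (du K z + du p z) - du B z)] /\
  [/\ dub e01 z = - hbar * G z, dub e12 z = - hbar * G z &
      dub e02 z = hbar ^+ 2 * (G z * (K z + p z))].
Proof.
move=> Dz e01 e12 e02.
have sK := smooth_Ku; have sp := smooth_p; have sB := smooth_Buu'.
have cst c : smooth D (fun=> c) := smooth_cst oD c.
have sKp := smoothD oD sK sp.
have [dKp bKp] := du_add sK sp Dz.
have dubp : dub p z = 0.
  case: hb2 => s hb; have := (du_mul s (cst (3 * hbar)^-1) Dz).2.
  by rewrite hb // (du_cst _ z).2 mul0r mulr0 addr0.
have e01E : e01 = fun w => - hbar * K w by apply/funext => w; rewrite mulNr.
have e12E : e12 = fun w => - hbar * (K w + p w) by apply/funext => w; rewrite mulNr.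
have e02E : e02 = fun w => hbar ^+ 2 * (K w * (K w + p w) + -1 * B w).
  by apply/funext => w; rewrite /e02; ring.
have sKKp := smoothM oD sK sKp; have sNB := smoothM oD (cst (-1)) sB.
(* Since B = K_u' + p K_u with p holomorphic, and [dub] of K_u' is the u-derivative of G, the result
   is G Gamma + p G; then Gamma = K_u - p. *)
have dubB : dub B z = K z * G z.
  have eB w : D w -> B w = du K w + p w * K w by move=> _; exact: Buu'E.
  have sdK := smooth_du oD sK.
  rewrite (du_eq oD eB Dz sB).2 (du_add sdK (smoothM oD sp sK) Dz).2.
  rewrite (du_mul sp sK Dz).2 dubp mul0r add0r dub_Ku // -(du_dub_comm oD sK Dz).
  rewrite (du_eq oD dub_Ku Dz (smooth_dub oD sK)).1.
  have := GammaE Dz; rewrite /Gammau; have := Guu_neq0 Dz.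
  move: (G z) (du G z) (K z) (p z) => g g' k q g0 e.
  have -> : g' = g * (g^-1 * g') by field.
  by rewrite e; ring.
rewrite e01E e12E e02E.
have [-> ->] := du_mul (cst (- hbar)) sK Dz.
have [-> ->] := du_mul (cst (- hbar)) sKp Dz.
have [-> ->] := du_mul (cst (hbar ^+ 2)) (smoothD oD sKKp sNB) Dz.
have [-> ->] := du_add sKKp sNB Dz.
have [-> ->] := du_mul sK sKp Dz.
have [-> ->] := du_mul (cst (-1)) sB Dz.
rewrite dKp bKp !(du_cst _ z).1 !(du_cst _ z).2 dubp dubB dub_Ku //.
by split; split; ring.
Qed.

Lemma gauge_act_NAH (A : C -> 'M[C]_3) : (forall z, D z -> A z = E z) ->
  conn_eq D (gauge_act A (connNAH X hbar w0)) (connGM hbar b0 b1 b2).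
Proof.
move=> AE z Dz; have sA : smooth_mx D A.
  by apply: (smooth_mx_eq oD) smooth_gauge => w /AE ->.
have [dE bE] := du_mx_eq oD AE Dz sA.
have [[d01 d12 d02] [b01 b12 b02]] := du_gauge_entries Dz.
have [b0E b1E] := picard_fuchs_coefs Dz.
have dKE : du K z = B z - p z * K z by rewrite Buu'E addrK.
rewrite /gauge_act /=; split.
  rewrite dE AE // inv_unitri (du_M3 _ _ _ _ _ _ _ _ _ z).1 d01 d12 d02.
  rewrite !(du_cst _ z).1 /chern_form (GammaE Dz) [b2 z in RHS]b2_eq.
  exact: (gauge_u hhbar dKE b0E b1E).
rewrite bE AE // inv_unitri (du_M3 _ _ _ _ _ _ _ _ _ z).2 b01 b12 b02 !(du_cst _ z).2.
exact: gauge_ub.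
Qed.

Lemma gauge_NAH_GM (A : C -> 'M[C]_3) :
  (forall z, D z -> frame_change (frameNAH X hbar w0 z) (frameGM hbar w0 z) (A z)) ->
  [/\ gauge_transformation D A,
      forall z, D z -> invmx (A z) = Ainv X hbar b1 b2 w0 z,
      forall z, D z -> Buu X hbar b1 b2 w0 z = B z
    & conn_eq D (gauge_act A (connNAH X hbar w0)) (connGM hbar b0 b1 b2)].
Proof.
move=> hA; have AE z : D z -> A z = E z by move=> Dz; apply/frame_changeP/hA.
split; [split| | |exact: gauge_act_NAH].
- by apply: (smooth_mx_eq oD) smooth_gauge => z /AE ->.
- by move=> z /AE ->; exact: unitri_unit.
- by move=> z Dz; rewrite AE // inv_unitri Ainv_unitri.
- by move=> z; exact: Buu_eq.
Qed.

(** Packages the gauge matrix without its formula; the equivalence yields existence and uniqueness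
    at each point at once. *)
Lemma frame_change_exists : exists A : C -> 'M[C]_3,
  forall z P, D z -> frame_change (frameNAH X hbar w0 z) (frameGM hbar w0 z) P <-> P = A z.
Proof. by exists (fun z => E z) => z P Dz; exact: frame_changeP. Qed.

End HodgeBundle.

Theorem proposition2p11 (R : realType) (n : nat) (hn : (1 <= n)%N)
    (D : set R[i]) (hD : coordinate_range D)
    (j : 'M[int]_(19, 22)) (X : R[i] -> hodge_dec R)
    (hX : complete_polarized_family n D j X)
    (hbar : R[i]) (hhbar : hbar != 0)
    (b0 b1 b2 : R[i] -> R[i])
    (hb0 : holomorphic D b0) (hb1 : holomorphic D b1) (hb2 : holomorphic D b2)
    (w0 : R[i] -> 'rV[R[i]]_22) (hw0 : local_frame X D w0)
    (hPF : picard_fuchs D hbar b0 b1 b2 w0) :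
  (forall z, D z -> exists! P : 'M[R[i]]_3,
     frame_change (frameNAH X hbar w0 z) (frameGM hbar w0 z) P) /\
  (forall A : R[i] -> 'M[R[i]]_3,
     (forall z, D z ->
        frame_change (frameNAH X hbar w0 z) (frameGM hbar w0 z) (A z)) ->
     [/\ gauge_transformation D A,
         forall z, D z -> invmx (A z) = Ainv X hbar b1 b2 w0 z,
         forall z, D z -> Buu X hbar b1 b2 w0 z = Buu' X hbar b2 w0 z
       & conn_eq D (gauge_act A (connNAH X hbar w0)) (connGM hbar b0 b1 b2)]) /\
  gauge_equivalent D (connNAH X hbar w0) (connGM hbar b0 b1 b2).
Proof.
have oD : Defs.openC D := hD.1.
(* The three [erefl] instantiate [w1], [w2], [w3] as the iterated [du_mx] of [w0]. *)
have gauge := gauge_NAH_GM oD hX hw0 erefl erefl erefl hhbar hb2 hPF.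
have [A hA] := frame_change_exists oD hX hw0 erefl erefl erefl hhbar hPF.
split; [|split; [exact: gauge|]].
  move=> z Dz; exists (A z); split; first exact/(hA z _ Dz).
  by move=> P /(hA z _ Dz).
have [gA _ _ eA] := gauge A (fun z Dz => iffRL (hA z _ Dz) erefl).
by exists A.
Qed.
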